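(* Let $c:[0,L]\to\mathbb{R}^3$ be a smooth regular curve parameterized by arc-length, with $\ddot c\ne0$ everywhere. Then $$\mathrm{TAT}(c)=\int_0^L|\boldsymbol{\tau}(s)|\,ds,$$ where $\boldsymbol{\tau}$ is the torsion of $c$.
   Context: Frenet frame: $\mathfrak{t}=\dot c$, $\mathfrak{n}=\dot{\mathfrak{t}}/|\dot{\mathfrak{t}}|$, $\mathfrak{b}=\mathfrak{t}\times\mathfrak{n}$; the torsion $\boldsymbol{\tau}$ is defined by $\dot{\mathfrak{b}}=-\boldsymbol{\tau}\,\mathfrak{n}$. $\mathbb{S}^2\subset\mathbb{R}^3$ is the unit sphere with geodesic distance $d_{\mathbb{S}^2}$; $\mathbb{RP}^2=\mathbb{S}^2/\{\pm1\}$ has elements $[y]$ and metric $d_{\mathbb{RP}^2}([y],[z])=\min\{d_{\mathbb{S}^2}(y,z),d_{\mathbb{S}^2}(y,-z)\}$. Polygonals. A polygonal $P$ in $\mathbb{R}^3$ has consecutive vertices $v_0,\dots,v_n$ and oriented segments $\sigma_i=[v_{i-1},v_i]$, identified with the vectors $v_i-v_{i-1}$, all of positive length (repeated consecutive vertices are discarded). The discrete binormals are $b_i:=\frac{\sigma_i\times\sigma_{i+1}}{\|\sigma_i\times\sigma_{i+1}\|}\in\mathbb{S}^2$, $i=1,\dots,n-1$. If $\sigma_i\times\sigma_{i+1}=0$, then in this formula $\sigma_{i+1}$ is replaced by $[v_i,v_{j+1}]$, where $j$ is the first index greater than $i$ with $\sigma_j\times\sigma_{j+1}\ne0$; if no such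 $j$ exists, $b_i:=b_{i-1}$. The total absolute torsion is $\mathrm{TAT}(P):=\sum_{i=2}^{n-1}d_{\mathbb{RP}^2}([b_{i-1}],[b_i])$ (it is $0$ if $P$ is planar). If $P$ is closed ($v_0=v_n$), indices are taken cyclically and the sum runs over all $n$ segments. For a curve $c:[a,b]\to\mathbb{R}^3$, $P\ll c$ ($P$ inscribed in $c$) means that there is a partition $a=\lambda_0<\dots<\lambda_n=b$ such that $P$ has vertices $v_i=c(\lambda_i)$. The modulus $\mu_c(P)$ is the maximum of the diameters of the arcs $c([\lambda_{i-1},\lambda_i])$. Define $\mathrm{TAT}(c):=\lim_{\varepsilon\to0^+}\sup\{\mathrm{TAT}(P):P\ll c,\ \mu_c(P)<\varepsilon\}$.
   Formalization: If c(0)=c(L), c is assumed smooth as a closed curve (derivatives of all orders agree at 0 and L); otherwise, since closed polygonals are treated cyclically, a nonplanar loop with a corner at c(0)=c(L) has TAT(c) greater than the integral of |torsion|. *)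

(* Defs.v *)
From HB Require Import structures.
From mathcomp Require Export all_boot all_order all_algebra.
From mathcomp Require Export all_classical all_reals all_analysis.

Set Implicit Arguments.
Unset Strict Implicit.
Unset Printing Implicit Defensive.

Import Order.TTheory GRing.Theory Num.Theory.
Export numFieldNormedType.Exports.

Local Open Scope classical_set_scope.
Local Open Scope ring_scope.

(** * Euclidean space R^3

    The norm [`|x|] that the library puts on ['rV[R]_3] is the sup norm; it is
    used here only through the topology. *)

Definition dot (R : realType) (u v : 'rV[R]_3) : R :=
  \sum_(i < 3) u 0 i * v 0 i.

Definition enorm (R : realType) (u : 'rV[R]_3) : R := Num.sqrt (dot u u).

Definition cross (R : realType) (u v : 'rV[R]_3) : 'rV[R]_3 :=
  let x (i : nat) : R := u 0 (inord i) in
  let y (i : nat) : R := v 0 (inord i) in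
  \row_(k < 3) [:: x 1%N * y 2%N - x 2%N * y 1%N;
                   x 2%N * y 0%N - x 0%N * y 2%N;
                   x 0%N * y 1%N - x 1%N * y 0%N]`_k.

Definition normalize (R : realType) (u : 'rV[R]_3) : 'rV[R]_3 :=
  (enorm u)^-1 *: u.

(** Geodesic distance of the unit sphere; meaningful for unit [y] and [z]. *)
Definition dS2 (R : realType) (y z : 'rV[R]_3) : R := acos (dot y z).

(** Distance of the classes [[y]] and [[z]] in the projective plane, given by
    representatives on the unit sphere. *)
Definition dRP2 (R : realType) (y z : 'rV[R]_3) : R :=
  Num.min (dS2 y z) (dS2 y (- z)).

(** * Curves on a closed interval

    A curve is a total function of which only the restriction to [`[a, b]]
    matters; derivatives are therefore limits of difference quotients within
    [`[a, b]], hence one-sided at the end points. *)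

Definition diff_quot (R : realType) (f : R -> 'rV[R]_3) (x y : R) : 'rV[R]_3 :=
  (y - x)^-1 *: (f y - f x).

Definition derivable_in (R : realType) (a b : R) (f : R -> 'rV[R]_3) (x : R) :
    Prop :=
  cvg (diff_quot f x y @[y --> within `[a, b] x^']).

Definition deriv_in (R : realType) (a b : R) (f : R -> 'rV[R]_3) (x : R) :
    'rV[R]_3 :=
  lim (diff_quot f x y @[y --> within `[a, b] x^']).

Definition derivn_in (R : realType) (a b : R) (k : nat) (f : R -> 'rV[R]_3) :
    R -> 'rV[R]_3 :=
  iter k (deriv_in a b) f.

Definition smooth_in (R : realType) (a b : R) (f : R -> 'rV[R]_3) : Prop :=
  forall (k : nat) (x : R), x \in `[a, b] -> derivable_in a b (derivn_in a b k f) x.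

(** If the end points of the curve coincide then it is closed, and being smooth
    as a closed curve means that its periodic extension is smooth, that is, that
    the derivatives of all orders agree at [a] and [b]. *)
Definition smooth_curve (R : realType) (a b : R) (c : R -> 'rV[R]_3) : Prop :=
  smooth_in a b c /\
  (c a = c b -> forall k : nat, derivn_in a b k c a = derivn_in a b k c b).

Definition arc_length_param (R : realType) (a b : R) (c : R -> 'rV[R]_3) : Prop :=
  forall s : R, s \in `[a, b] -> enorm (deriv_in a b c s) = 1.

(** * Frenet frame and torsion *)

Definition tangent (R : realType) (a b : R) (c : R -> 'rV[R]_3) : R -> 'rV[R]_3 :=
  deriv_in a b c.

Definition normal (R : realType) (a b : R) (c : R -> 'rV[R]_3) (s : R) :
    'rV[R]_3 :=
  normalize (deriv_in a b (tangent a b c) s).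

Definition binormal (R : realType) (a b : R) (c : R -> 'rV[R]_3) (s : R) :
    'rV[R]_3 :=
  cross (tangent a b c s) (normal a b c s).

(** The scalar [k] such that the derivative of the binormal is [- k] times the
    normal; it is unique when the second derivative does not vanish. *)
Definition torsion (R : realType) (a b : R) (c : R -> 'rV[R]_3) (s : R) : R :=
  xget 0 [set k : R | deriv_in a b (binormal a b c) s = - k *: normal a b c s].

(** * Polygonals

    A polygonal is the sequence [:: v_0; ...; v_n] of its vertices. *)

Fixpoint discard_repeated (T : eqType) (w : seq T) : seq T :=
  if w is x :: w' then
    if w' is y :: _ then
      if x == y then discard_repeated w' else x :: discard_repeated w'
    else [:: x]
  else [::].

(** In the discrete binormals the vertices are given by [v : nat -> R^3], so
    that open polygonals and cyclic indices are treated alike. *)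

Definition segment (R : realType) (v : nat -> 'rV[R]_3) (i : nat) : 'rV[R]_3 :=
  v i - v i.-1.

(** [J i] lists, in increasing order, the indices [j > i] among which one looks
    for the first with [segment v j] and [segment v j.+1] independent.
    The value at [0] is an arbitrary unit vector.  If no suitable [j] exists for
    [i = 1] then the polygonal lies on a line, all the [discrete_binormal v J i]
    are equal to that vector, and the total absolute torsion is 0. *)
Fixpoint discrete_binormal (R : realType) (v : nat -> 'rV[R]_3)
    (J : nat -> seq nat) (i : nat) : 'rV[R]_3 :=
  if i is i'.+1 then
    if cross (segment v i) (segment v i.+1) != 0 then
      normalize (cross (segment v i) (segment v i.+1))
    else if [seq j <- J i | cross (segment v j) (segment v j.+1) != 0] is j :: _
    then normalize (cross (segment v i) (v j.+1 - v i))
    else discrete_binormal v J i'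
  else delta_mx 0 0.

(** [w] has no repeated consecutive entries and [n] is its number of segments.
    In the closed case the vertices are indexed modulo [n], the search for [j]
    goes once around, and the cyclic sum over [n] consecutive pairs of binormals
    is taken over [i = 2, ..., n + 1], where [b_(n+1) = b_1]. *)
Definition TAT_open (R : realType) (w : seq 'rV[R]_3) : R :=
  let n := (size w).-1 in
  let b := discrete_binormal (nth 0 w) (fun i => iota i.+1 (n - i.+1)) in
  \sum_(2 <= i < n) dRP2 (b i.-1) (b i).

Definition TAT_closed (R : realType) (w : seq 'rV[R]_3) : R :=
  let n := (size w).-1 in
  let b := discrete_binormal (fun k => nth 0 w (k %% n)) (fun i => iota i.+1 n) in
  \sum_(2 <= i < n.+2) dRP2 (b i.-1) (b i).

Definition TAT_polygonal (R : realType) (w : seq 'rV[R]_3) : R :=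
  let w' := discard_repeated w in
  if head 0 w' == last 0 w' then TAT_closed w' else TAT_open w'.

(** * Total absolute torsion of a curve

    A partition [a = l_0 < l_1 < ... < l_n = b] is encoded, as in
    [itv_partition a b l], by the sequence [l = [:: l_1; ...; l_n]]. *)

Definition inscribed (R : realType) (a : R) (c : R -> 'rV[R]_3) (l : seq R) :
    seq 'rV[R]_3 :=
  map c (a :: l).

Definition diam (R : realType) (A : set 'rV[R]_3) : \bar R :=
  ereal_sup [set (enorm (p.1 - p.2))%:E | p in A `*` A].

Definition modulus (R : realType) (a : R) (c : R -> 'rV[R]_3) (l : seq R) :
    \bar R :=
  \big[maxe/0%E]_(i < size l) diam (c @` `[nth 0 (a :: l) i, nth 0 (a :: l) i.+1]).

Definition TAT_sup (R : realType) (a b : R) (c : R -> 'rV[R]_3) (e : R) : \bar R :=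
  ereal_sup [set (TAT_polygonal (inscribed a c l))%:E |
             l in [set l | itv_partition a b l /\ (modulus a c l < e%:E)%E]].

Definition TAT (R : realType) (a b : R) (c : R -> 'rV[R]_3) : \bar R :=
  lim (TAT_sup a b c e @[e --> 0^'+]).

(* Main.v *)
Require Import Defs.
From mathcomp Require Import ring lra zify.

Set Implicit Arguments.
Unset Strict Implicit.
Unset Printing Implicit Defensive.

Import Order.TTheory GRing.Theory Num.Theory.

Local Open Scope classical_set_scope.
Local Open Scope ring_scope.

(** The angle between the planes of two consecutive corners of a polygonal
    inscribed in [c] is, to first order, the integral of the torsion over a
    third of the parameter interval that the two corners span.

    Take parameters [x < y < z < w] and write [d], [e], [e'] and [f] for the
    divided differences [c[y,z]], [c[x,y,z]], [c[y,z,w]] and [c[x,y,z,w]].  The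
    planes through [c x, c y, c z] and through [c y, c z, c w] both contain [d],
    and their normals are positive multiples of [cross d e] and [cross d e'].
    Since [e' - e = (w - x) f], the identity
    [cross (cross d e) (cross d e') = dot d (cross e e') *: d] gives exactly
    [sin angle = (w - x) |det (d, e, f)| |d| / (|cross d e| |cross d e'|)]
    ([plane_angleE]).  When the four parameters tend to [s], the vectors [d],
    [e], [e'], [f] tend to [c' s], [c'' s / 2], [c'' s / 2], [c''' s / 6], so
    that the angle divided by [w - x] tends to [|torsion s| / 3].

    Let [G] be a primitive of [|torsion|].  By compactness of the segment the
    angle differs from [(G w - G x) / 3] by at most [eps (w - x)], for all
    quadruples in a short enough interval ([plane_angle_uniform]).  Summing over
    the consecutive quadruples of a fine partition, both the main terms and the
    errors telescope: each step of the partition is counted three times, except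
    for the few steps next to the ends, and the sum of the angles is close to
    [G L - G 0] ([sum_plane_angle_cvg]).  This holds for every partition with
    small steps, hence for the suprema over the partitions with small modulus.

    A closed polygonal is handled by extending the curve periodically to
    [[0, 2 L]], where the cyclic sum becomes a sum over consecutive quadruples
    that ends two steps after [L] instead of at [L].

    Two facts link this with the definitions.  A unit speed curve is locally
    almost isometric, so a small modulus forces a small step
    ([modulus_mesh]).  And, with [t], [a], [j] the first three derivatives of
    the curve, differentiating the binormal [|a|^-1 *: cross t a] gives the
    torsion [det (t, a, j) / |a|^2] ([binormal_derivative]). *)

(** * Vector algebra in R^3 *)

Section VectorAlgebra.
Variable R : realType.
Implicit Types (u v w y z d e f : 'rV[R]_3) (a : R).

Lemma dot3E u v : dot u v =
  u 0 (inord 0) * v 0 (inord 0) + u 0 (inord 1) * v 0 (inord 1)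
  + u 0 (inord 2) * v 0 (inord 2).
Proof.
rewrite /dot !big_ord_recl big_ord0 addr0 addrA.
by congr (_ * _ + _ * _ + _ * _); congr (_ 0 _); apply/val_inj; rewrite /= inordK.
Qed.

Lemma rV3P u v : u 0 (inord 0) = v 0 (inord 0) -> u 0 (inord 1) = v 0 (inord 1) ->
  u 0 (inord 2) = v 0 (inord 2) -> u = v.
Proof.
move=> h0 h1 h2; apply/rowP => i; rewrite -(inord_val i).
by case: i => -[|[|[|]]].
Qed.

Lemma cross0E u v : cross u v 0 (inord 0) =
  u 0 (inord 1) * v 0 (inord 2) - u 0 (inord 2) * v 0 (inord 1).
Proof. by rewrite /cross mxE inordK. Qed.

Lemma cross1E u v : cross u v 0 (inord 1) =
  u 0 (inord 2) * v 0 (inord 0) - u 0 (inord 0) * v 0 (inord 2).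
Proof. by rewrite /cross mxE inordK. Qed.

Lemma cross2E u v : cross u v 0 (inord 2) =
  u 0 (inord 0) * v 0 (inord 1) - u 0 (inord 1) * v 0 (inord 0).
Proof. by rewrite /cross mxE inordK. Qed.

Definition cross3E := (cross0E, cross1E, cross2E).

Ltac coordinates := rewrite ?dot3E ?(cross3E, mxE).
Ltac vring := first [ apply: rV3P; coordinates; ring | coordinates; ring ].

Lemma crossZl a u v : cross (a *: u) v = a *: cross u v.
Proof. vring. Qed.

Lemma crossZr a u v : cross u (a *: v) = a *: cross u v.
Proof. vring. Qed.

Lemma dotZl a u v : dot (a *: u) v = a * dot u v.
Proof. vring. Qed.

Lemma dotZr a u v : dot u (a *: v) = a * dot u v.
Proof. vring. Qed.

Lemma dotNr u v : dot u (- v) = - dot u v.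
Proof. vring. Qed.

Lemma cross_crossl d e f : cross (cross d e) (cross d f) = dot d (cross e f) *: d.
Proof. vring. Qed.

Lemma lagrange_identity u v :
  dot (cross u v) (cross u v) = dot u u * dot v v - dot u v ^+ 2.
Proof. vring. Qed.

Lemma dot_ge0 u : 0 <= dot u u.
Proof. by apply: sumr_ge0 => i _; rewrite -expr2 sqr_ge0. Qed.

Lemma dot_eq0 u : (dot u u == 0) = (u == 0).
Proof.
apply/eqP/eqP => [|->]; last by rewrite /dot big1// => i _; rewrite mxE mul0r.
move=> /psumr_eq0P h; apply/rowP => i; rewrite mxE; apply/eqP.
by rewrite -sqrf_eq0 expr2 h// => j _; rewrite -expr2 sqr_ge0.
Qed.

Lemma enorm_ge0 u : 0 <= enorm u.
Proof. exact: sqrtr_ge0. Qed.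

Lemma enorm_sqr u : enorm u ^+ 2 = dot u u.
Proof. by rewrite sqr_sqrtr// dot_ge0. Qed.

Lemma enorm_eq0 u : (enorm u == 0) = (u == 0).
Proof. by rewrite -sqrf_eq0 enorm_sqr dot_eq0. Qed.

Lemma enorm_gt0 u : (0 < enorm u) = (u != 0).
Proof. by rewrite lt_neqAle enorm_ge0 andbT eq_sym enorm_eq0. Qed.

Lemma enormZ a u : enorm (a *: u) = `|a| * enorm u.
Proof.
by rewrite /enorm dotZl dotZr mulrA -expr2 sqrtrM ?sqr_ge0// sqrtr_sqr.
Qed.

Lemma enorm_normalize u : u != 0 -> enorm (normalize u) = 1.
Proof.
move=> u0; rewrite /normalize enormZ normfV ger0_norm ?enorm_ge0// mulVf//.
by rewrite enorm_eq0.
Qed.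

Lemma normalizeZ a u : 0 < a -> normalize (a *: u) = normalize u.
Proof.
move=> a0; rewrite /normalize enormZ gtr0_norm// scalerA invfM mulrAC.
by rewrite mulVf ?mul1r// gt_eqF.
Qed.

Lemma dot_sqr_cross_unit y z : enorm y = 1 -> enorm z = 1 ->
  dot y z ^+ 2 = 1 - enorm (cross y z) ^+ 2.
Proof.
move=> y1 z1; rewrite enorm_sqr lagrange_identity -!enorm_sqr y1 z1.
by rewrite expr1n mulr1 opprB addrCA subrr addr0.
Qed.

End VectorAlgebra.

(** * Distance of the projective plane *)

Section ProjectiveAngle.
Variable R : realType.
Implicit Types (u v y z d e f : 'rV[R]_3).

(** Whatever the sign of [dot y z], the smaller of the two supplementary angles
    is the one in [[0, pi/2]], where the sine is injective. *)
Lemma dRP2_asin y z : enorm y = 1 -> enorm z = 1 ->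
  dRP2 y z = asin (enorm (cross y z)) :> R.
Proof.
move=> y1 z1; have sq := dot_sqr_cross_unit y1 z1.
rewrite /dRP2 /dS2 dotNr; set x := dot y z in sq *.
have x1 : -1 <= x <= 1.
  rewrite -ler_norml -(@expr_le1 _ 2)// real_normK ?num_real//.
  by rewrite sq gerBl sqr_ge0.
have asinE (t : R) : 0 <= t <= 1 -> t ^+ 2 = x ^+ 2 -> acos t = asin (enorm (cross y z)).
  move=> /andP[t0 t1] tx.
  have tN1 : -1 <= t <= 1 by rewrite t1 andbT (le_trans _ t0)// lerN10.
  have -> : enorm (cross y z) = sin (acos t).
    by rewrite sin_acos// tx sq subKr sqrtr_sqr ger0_norm// enorm_ge0.
  rewrite sinK// in_itv/= (le_trans _ (acos_ge0 tN1)) ?oppr_le0 ?divr_ge0 ?pi_ge0//=.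
  rewrite leNgt; apply/negP => lt_pi2.
  have : cos (acos t) < cos (pi / 2 : R).
    rewrite ltr_cos ?in_itv/= ?acos_ge0 ?acos_lepi//.
    rewrite divr_ge0 ?pi_ge0//= ler_pdivrMr// ler_peMr ?pi_ge0//.
    by rewrite ler1n.
  by rewrite cos_pihalf acosK ?in_itv//= ltNge t0.
rewrite acosN//.
have [x0|x0] := leP 0 x.
  rewrite -(asinE x) ?x0 ?(andP x1).2//; apply/min_idPl.
  rewrite -acosN//; have N1 : -1 <= - x <= 1 by rewrite lerNl opprK lerNl andbC.
  rewrite leNgt -ltr_cos ?in_itv/= ?acos_ge0 ?acos_lepi//.
  rewrite !acosK ?in_itv//= -leNgt; lra.
have N1 : -1 <= - x <= 1 by rewrite lerNl opprK lerNl andbC.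
rewrite -(asinE (- x)) ?sqrrN// ?acosN//; last by rewrite (andP N1).2 oppr_ge0 ltW.
apply/min_idPr; rewrite -acosN//.
rewrite leNgt -ltr_cos ?in_itv/= ?acos_ge0 ?acos_lepi//.
rewrite !acosK ?in_itv//= -leNgt; lra.
Qed.

End ProjectiveAngle.

(** * Divided differences *)

Section DerivativeOn.
Variables (R : realType) (A B : R).
Implicit Types (f df ddf d3f : R -> R) (p : {poly R}) (x y z w : R).

(** The hypotheses of the mean value theorem, so that nothing is said about
    derivatives at the end points. *)
Definition derivative_on f df :=
  {within `[A, B], continuous f} /\ forall x, x \in `]A, B[ -> is_derive x 1 f (df x).

Lemma derivative_on_horner p : derivative_on (horner p) (horner p^`()).
Proof.
split=> [|x _]; first exact/continuous_subspaceT/continuous_horner.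
by apply: DeriveDef; [exact: derivable_horner | rewrite derivE derive1E].
Qed.

Lemma derivative_onB f df g dg :
  derivative_on f df -> derivative_on g dg ->
  derivative_on (fun x => f x - g x) (fun x => df x - dg x).
Proof.
move=> [cf f'] [cg g']; split=> [x|x xAB]; first by apply: cvgB; [exact: cf|exact: cg].
by apply: is_deriveB; [exact: f'|exact: g'].
Qed.

Lemma mean_value f df x y : derivative_on f df -> A <= x -> x < y -> y <= B ->
  exists2 xi, x < xi < y & f y - f x = df xi * (y - x).
Proof.
move=> [cf f'] Ax xy yB.
have f'xy z : z \in `]x, y[ -> is_derive z 1 f (df z).
  rewrite in_itv/= => /andP[xz zy]; apply: f'.
  by rewrite in_itv/= (le_lt_trans Ax xz) (lt_le_trans zy yB).
have cfxy : {within `[x, y], continuous f}.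
  apply: continuous_subspaceW cf => z /=; rewrite !in_itv/= => /andP[xz zy].
  by rewrite (le_trans Ax xz) (le_trans zy yB).
have [xi] := MVT xy f'xy cfxy.
by rewrite in_itv/= => xiP ->; exists xi.
Qed.

Lemma rolle_zeros2 f df x y : derivative_on f df -> A <= x -> x < y -> y <= B ->
  f x = 0 -> f y = 0 -> exists2 xi, x < xi < y & df xi = 0.
Proof.
move=> f' Ax xy yB fx fy; have [xi xiP] := mean_value f' Ax xy yB.
rewrite fx fy subr0 => /esym/eqP; rewrite mulf_eq0 => /orP[/eqP|]; first by exists xi.
by rewrite subr_eq0 gt_eqF.
Qed.

Lemma rolle_zeros3 f df ddf x y z :
  derivative_on f df -> derivative_on df ddf ->
  A <= x -> x < y -> y < z -> z <= B -> f x = 0 -> f y = 0 -> f z = 0 ->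
  exists2 xi, x < xi < z & ddf xi = 0.
Proof.
move=> f' f'' Ax xy yz zB fx fy fz.
have [a /andP[xa ay] da] := rolle_zeros2 f' Ax xy (ltW (lt_le_trans yz zB)) fx fy.
have [b /andP[yb bz] db] := rolle_zeros2 f' (ltW (le_lt_trans Ax xy)) yz zB fy fz.
have [|||xi /andP[axi xib] dxi] := rolle_zeros2 f'' _ _ _ da db.
- exact: ltW (le_lt_trans Ax xa).
- exact: lt_trans ay yb.
- exact: ltW (lt_le_trans bz zB).
by exists xi => //; rewrite (lt_trans xa axi) (lt_trans xib bz).
Qed.

Lemma rolle_zeros4 f df ddf d3f x y z w :
  derivative_on f df -> derivative_on df ddf -> derivative_on ddf d3f ->
  A <= x -> x < y -> y < z -> z < w -> w <= B ->
  f x = 0 -> f y = 0 -> f z = 0 -> f w = 0 ->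
  exists2 xi, x < xi < w & d3f xi = 0.
Proof.
move=> f' f'' f3 Ax xy yz zw wB fx fy fz fw.
have zB := ltW (lt_le_trans zw wB); have yB := ltW (lt_le_trans yz zB).
have Ay := ltW (le_lt_trans Ax xy); have Az := ltW (le_lt_trans Ay yz).
have [a /andP[xa ay] da] := rolle_zeros2 f' Ax xy yB fx fy.
have [b /andP[yb bz] db] := rolle_zeros2 f' Ay yz zB fy fz.
have [c /andP[zc cw] dc] := rolle_zeros2 f' Az zw wB fz fw.
have [||||xi /andP[axi xic] dxi] := rolle_zeros3 f'' f3 _ _ _ _ da db dc.
- exact: ltW (le_lt_trans Ax xa).
- exact: lt_trans ay yb.
- exact: lt_trans bz zc.
- exact: ltW (lt_le_trans cw wB).
by exists xi => //; rewrite (lt_trans xa axi) (lt_trans xic cw).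
Qed.

End DerivativeOn.

Section DividedDifferences.
Variables (R : realType) (V : lmodType R).
Implicit Types (f : R -> V) (x y z w : R).

(** Stated for any module so that they apply both to the curve and, with values
    in [R^o], to its coordinates, to which the mean value theorem applies. *)
Definition divdiff1 f x y : V := (y - x)^-1 *: (f y - f x).
Definition divdiff2 f x y z : V :=
  (z - x)^-1 *: (divdiff1 f y z - divdiff1 f x y).
Definition divdiff3 f x y z w : V :=
  (w - x)^-1 *: (divdiff2 f y z w - divdiff2 f x y z).

End DividedDifferences.

Section DividedDifferenceMeanValue.
Variables (R : realType) (A B : R).
Implicit Types (f df ddf d3f : R -> R^o) (x y z w : R).

Lemma divdiff1_mean f df x y : derivative_on A B f df ->
  A <= x -> x < y -> y <= B ->
  exists2 xi, x <= xi <= y & divdiff1 f x y = df xi.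
Proof.
move=> f' Ax xy yB; have [xi /andP[x1 x2] e] := mean_value f' Ax xy yB.
exists xi; first by rewrite !ltW.
rewrite /divdiff1 e /GRing.scale/= mulrC mulfK//.
by rewrite subr_eq0 gt_eqF.
Qed.

(** Rolle's theorem for the difference of [f] and its interpolating polynomial
    in Newton's form, whose leading coefficient is the divided difference. *)
Lemma divdiff2_mean f df ddf x y z :
  derivative_on A B f df -> derivative_on A B df ddf ->
  A <= x -> x < y -> y < z -> z <= B ->
  exists2 xi, x <= xi <= z & divdiff2 f x y z = ddf xi / 2.
Proof.
move=> f' f'' Ax xy yz zB.
set d := divdiff1 f x y; set e := divdiff2 f x y z.
have yx : y - x != 0 by rewrite subr_eq0 gt_eqF.
have zy : z - y != 0 by rewrite subr_eq0 gt_eqF.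
have zx : z - x != 0 by rewrite subr_eq0 gt_eqF// (lt_trans xy).
pose p : {poly R} := (f x)%:P + (d : R)%:P * ('X - x%:P)
  + (e : R)%:P * (('X - x%:P) * ('X - y%:P)).
have pE t : p.[t] = f x + d * (t - x) + e * ((t - x) * (t - y)).
  by rewrite !hornerE.
have [|||xi /andP[x1 x2] xi0] := rolle_zeros3
  (derivative_onB f' (derivative_on_horner _ _ p))
  (derivative_onB f'' (derivative_on_horner _ _ p^`())) Ax xy yz zB.
- by rewrite pE !subrr mul0r !mulr0 !addr0 subrr.
- rewrite pE subrr mulr0 mulr0 addr0 /d /divdiff1 /GRing.scale/=.
  by field.
- rewrite pE /e /d /divdiff2 /divdiff1 /GRing.scale/=.
  by field; rewrite yx zy zx.
exists xi; first by rewrite !ltW.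
move/eqP: xi0; rewrite subr_eq0 => /eqP ->.
rewrite /p !poly.derivE !hornerE /=; by field.
Qed.

Lemma divdiff3_mean f df ddf d3f x y z w :
  derivative_on A B f df -> derivative_on A B df ddf -> derivative_on A B ddf d3f ->
  A <= x -> x < y -> y < z -> z < w -> w <= B ->
  exists2 xi, x <= xi <= w & divdiff3 f x y z w = d3f xi / 6.
Proof.
move=> f' f'' f3 Ax xy yz zw wB.
set d := divdiff1 f x y; set e := divdiff2 f x y z; set g := divdiff3 f x y z w.
have yx : y - x != 0 by rewrite subr_eq0 gt_eqF.
have zy : z - y != 0 by rewrite subr_eq0 gt_eqF.
have wz : w - z != 0 by rewrite subr_eq0 gt_eqF.
have zx : z - x != 0 by rewrite subr_eq0 gt_eqF// (lt_trans xy).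
have wy : w - y != 0 by rewrite subr_eq0 gt_eqF// (lt_trans yz).
have wx : w - x != 0 by rewrite subr_eq0 gt_eqF// (lt_trans xy)// (lt_trans yz).
pose p : {poly R} := (f x)%:P + (d : R)%:P * ('X - x%:P)
  + (e : R)%:P * (('X - x%:P) * ('X - y%:P))
  + (g : R)%:P * (('X - x%:P) * ('X - y%:P) * ('X - z%:P)).
have pE t : p.[t] = f x + d * (t - x) + e * ((t - x) * (t - y))
    + g * ((t - x) * (t - y) * (t - z)).
  by rewrite !hornerE.
have [||||xi /andP[x1 x2] xi0] := rolle_zeros4
  (derivative_onB f' (derivative_on_horner _ _ p))
  (derivative_onB f'' (derivative_on_horner _ _ p^`()))
  (derivative_onB f3 (derivative_on_horner _ _ p^`()^`())) Ax xy yz zw wB.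
- by rewrite pE !subrr !mul0r !mulr0 !addr0 subrr.
- rewrite pE subrr !(mulr0, mul0r, addr0) /d /divdiff1 /GRing.scale/=.
  by field.
- rewrite pE subrr !(mulr0, addr0) /e /d /divdiff2 /divdiff1 /GRing.scale/=.
  by field; rewrite yx zy zx.
- rewrite pE /g /e /d /divdiff3 /divdiff2 /divdiff1 /GRing.scale/=.
  by field; rewrite yx zy zx wz wy wx.
exists xi; first by rewrite !ltW.
move/eqP: xi0; rewrite subr_eq0 => /eqP ->.
rewrite /p !poly.derivE !hornerE /=; by field.
Qed.

End DividedDifferenceMeanValue.

(** * Limits in R^3 *)

Section VectorLimits.
Variables (R : realType) (T : Type) (F : set_system T).
Context {FF : Filter F}.
Implicit Types (u v : T -> 'rV[R]_3) (a b : 'rV[R]_3).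

Lemma cvg_coord u a k : u t @[t --> F] --> a -> u t 0 k @[t --> F] --> a 0 k.
Proof. by move=> ua; exact: (cvg_comp _ _ ua (@coord_continuous _ _ _ 0 k a)). Qed.

Lemma cvg_rV u a : (forall k, u t 0 k @[t --> F] --> a 0 k) -> u t @[t --> F] --> a.
Proof.
move=> ua; have row_sum (v : 'rV[R]_3) : v = \sum_k v 0 k *: delta_mx 0 k.
  by rewrite [LHS]row_sum_delta.
rewrite [a]row_sum; under eq_fun do rewrite [u _]row_sum !big_ord_recl big_ord0.
rewrite !big_ord_recl big_ord0.
by do 3![apply: cvgD; first exact: cvgZr_tmp]; exact: cvg_cst.
Qed.

Lemma cvg_dot u v a b : u t @[t --> F] --> a -> v t @[t --> F] --> b ->
  dot (u t) (v t) @[t --> F] --> dot a b.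
Proof.
move=> ua vb; rewrite dot3E; under eq_fun do rewrite dot3E.
by apply: cvgD; [apply: cvgD|]; apply: cvgM; exact: cvg_coord.
Qed.

Lemma cvg_cross u v a b : u t @[t --> F] --> a -> v t @[t --> F] --> b ->
  cross (u t) (v t) @[t --> F] --> cross a b.
Proof.
move=> ua vb; apply: cvg_rV => k; rewrite -(inord_val k).
case: k => -[|[|[|//]]] _ /=; rewrite cross3E; under eq_fun do rewrite cross3E;
  by apply: cvgB; apply: cvgM; exact: cvg_coord.
Qed.

Lemma cvg_enorm u a : u t @[t --> F] --> a -> enorm (u t) @[t --> F] --> enorm a.
Proof.
by move=> ua; exact: (cvg_comp _ _ (cvg_dot ua ua) (@sqrt_continuous _ _)).
Qed.

End VectorLimits.

(** * The angle between two consecutive osculating planes *)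

Section MeanValueLimits.
Variables (R : realType) (A B : R) (T : Type) (F : set_system T).
Context {FF : Filter F}.
Implicit Types (x w h : T -> R) (f : R -> R) (s : R).

(** Mean values [f xi] over an interval that shrinks to [s] tend to [f s];
    continuity is relative to the segment, so that [s] may be an end point. *)
Lemma cvg_mean x w h f s : {within `[A, B], continuous f} -> s \in `[A, B] ->
  x t @[t --> F] --> s -> w t @[t --> F] --> s ->
  (\forall t \near F, A <= x t /\ w t <= B) ->
  (\forall t \near F, exists2 xi, x t <= xi <= w t & h t = f xi) ->
  h t @[t --> F] --> f s.
Proof.
move=> /subspace_continuousP cf sAB xs ws AB hf.
have {}cf := cf s sAB; apply/cvgrPdist_lt => e e0.
have [d /= d0 fd] : exists2 d, 0 < d &
    forall y, `|s - y| < d -> y \in `[A, B] -> `|f s - f y| < e.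
  move/cvgrPdist_lt: cf => /(_ e e0) [d /= d0 fd].
  by exists d => // y yd yAB; exact: fd.
have [/cvgrPdist_lt xs' /cvgrPdist_lt ws'] := (xs, ws).
near=> t.
have [xi /andP[xxi xiw] ->] : exists2 xi, x t <= xi <= w t & h t = f xi.
  by near: t.
have [Ax wB] : A <= x t /\ w t <= B by near: t.
have xd : `|s - x t| < d by near: t; exact: xs'.
have wd : `|s - w t| < d by near: t; exact: ws'.
apply: fd; last by rewrite in_itv/= (le_trans Ax xxi) (le_trans xiw wB).
move: xd wd; rewrite !ltr_norml => /andP[x1 x2] /andP[w1 w2].
by apply/andP; split; lra.
Unshelve. all: by end_near. Qed.

End MeanValueLimits.

Section AsinOverId.
Variable R : realType.

Lemma asin_mean (u : R) : 0 <= u <= 1 / 2 ->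
  exists2 xi, 0 <= xi <= u & asin u = (Num.sqrt (1 - xi ^+ 2))^-1 * u.
Proof.
move=> /andP[]; rewrite le_eqVlt => /orP[/eqP <- _|u0 u12].
  exists 0; first by rewrite lexx.
  rewrite mulr0 -[in LHS](@sin0 R) sinK// in_itv/=.
  by rewrite oppr_le0 divr_ge0 ?pi_ge0.
have asin' (x : R) : x \in `]0, u[ ->
    is_derive x 1 (@asin R) (Num.sqrt (1 - x ^+ 2))^-1.
  rewrite in_itv/= => /andP[x0 xu]; apply: is_derive1_asin.
  by apply/andP; split; lra.
have casin : {within `[0, u], continuous (@asin R)}.
  apply: continuous_in_subspaceT => x; rewrite inE/= in_itv/= => /andP[x0 xu].
  by apply: continuous_asin; apply/andP; split; lra.
have [xi] := MVT u0 asin' casin.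
rewrite in_itv/= => /andP[xi0 xiu]; rewrite subr0.
have -> : asin (0 : R) = 0.
  rewrite -[in LHS](@sin0 R) sinK// in_itv/=.
  by rewrite oppr_le0 divr_ge0 ?pi_ge0.
by rewrite subr0 => ->; exists xi => //; rewrite !ltW.
Qed.

(** As [asin u / u] tends to 1 when [u] does to 0, an angle and its sine have
    the same first order behaviour. *)
Lemma cvg_asin_over (T : Type) (F : set_system T) {FF : Filter F}
    (d u : T -> R) (l : R) :
  d t @[t --> F] --> 0 -> u t @[t --> F] --> l ->
  (\forall t \near F, 0 < d t /\ 0 <= u t) ->
  asin (d t * u t) / d t @[t --> F] --> l.
Proof.
move=> d0 ul du0.
have dul : d t * u t @[t --> F] --> 0 by rewrite -[0](mul0r l); exact: cvgM.
(* The quotient [asin v / v], with the value at [v = 0] that makes it a mean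
   value of the derivative of [asin]. *)
pose q t := if d t * u t == 0 then 1 else asin (d t * u t) / (d t * u t).
have q1 : q t @[t --> F] --> (1 : R).
  have c : {within `[(0:R), 1 / 2], continuous fun x : R => (Num.sqrt (1 - x ^+ 2))^-1}.
    apply: continuous_in_subspaceT => x; rewrite inE/= in_itv/= => /andP[x0 x2].
    apply: cvgV.
      rewrite sqrtr_eq0 -ltNge; nra.
    apply: (@continuous_comp _ _ _ (fun x : R => 1 - x ^+ 2) Num.sqrt); last exact: sqrt_continuous.
    by apply: continuousB; [exact: cst_continuous|exact: exprn_continuous].
  have -> : 1 = (Num.sqrt (1 - (0 : R) ^+ 2))^-1.
    by rewrite expr0n/= subr0 sqrtr1 invr1.
  apply: (@cvg_mean _ 0 (1 / 2) _ _ _ (cst 0) (fun t => d t * u t) q _ 0 c).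
  - by rewrite in_itv/=; apply/andP; split; lra.
  - exact: cvg_cst.
  - exact: dul.
  - near=> t; split=> //=; apply/ltW; near: t.
    by apply: (cvgr_lt 0 dul); lra.
  - near=> t; have [d1 u1] : 0 < d t /\ 0 <= u t by near: t.
    have du : d t * u t <= 1 / 2 by apply/ltW; near: t; apply: (cvgr_lt 0 dul); lra.
    have du_ge0 : 0 <= d t * u t by rewrite mulr_ge0// ltW.
    rewrite /q; case: ifPn => [_|du0'].
      exists 0; first by rewrite lexx.
      by rewrite expr0n/= subr0 sqrtr1 invr1.
    have [|xi xiP ->] := @asin_mean (d t * u t); first by rewrite du_ge0.
    by exists xi => //; rewrite mulfK.
apply: cvg_trans (_ : q t * u t @[t --> F] --> l); last first.
  by rewrite -[l]mul1r; exact: cvgM.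
apply: near_eq_cvg; near=> t.
have [d1 u1] : 0 < d t /\ 0 <= u t by near: t.
rewrite /q; case: ifPn => [/eqP du|du].
  rewrite du mul1r -[in RHS](@sin0 R) sinK ?mul0r.
    by move/eqP: du; rewrite mulf_eq0 gt_eqF//= => /eqP.
  by rewrite in_itv/= oppr_le0 divr_ge0 ?pi_ge0.
by move: du; rewrite mulf_eq0 negb_or => /andP[? ?]; field; apply/andP.
Unshelve. all: by end_near. Qed.

End AsinOverId.

Section OsculatingPlanes.
Variables (R : realType) (c : R -> 'rV[R]_3).

(** Up to the factor [z - x], the two slopes differ by the second divided
    difference, so that either slope can be used for the first vector. *)
Lemma cross_chordsl x y z : x < y -> y < z ->
  cross (c y - c x) (c z - c y) =
  ((y - x) * (z - y) * (z - x)) *: cross (divdiff1 c y z) (divdiff2 c x y z).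
Proof.
move=> xy yz.
have yx : y - x != 0 by rewrite subr_eq0 gt_eqF.
have zy : z - y != 0 by rewrite subr_eq0 gt_eqF.
have zx : z - x != 0 by rewrite subr_eq0 gt_eqF// (lt_trans xy).
by apply: rV3P; rewrite !(cross3E, mxE); field; rewrite yx zy zx.
Qed.

Lemma cross_chordsr x y z : x < y -> y < z ->
  cross (c y - c x) (c z - c y) =
  ((y - x) * (z - y) * (z - x)) *: cross (divdiff1 c x y) (divdiff2 c x y z).
Proof.
move=> xy yz.
have yx : y - x != 0 by rewrite subr_eq0 gt_eqF.
have zy : z - y != 0 by rewrite subr_eq0 gt_eqF.
have zx : z - x != 0 by rewrite subr_eq0 gt_eqF// (lt_trans xy).
by apply: rV3P; rewrite !(cross3E, mxE); field; rewrite yx zy zx.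
Qed.

Definition plane_angle x y z w :=
  dRP2 (normalize (cross (c y - c x) (c z - c y)))
       (normalize (cross (c z - c y) (c w - c z))).

(** The sine of [plane_angle c x y z w] divided by [w - x]. *)
Definition plane_angle_rate x y z w :=
  let d := divdiff1 c y z in
  let e := divdiff2 c x y z in let e' := divdiff2 c y z w in
  `|dot d (cross e (divdiff3 c x y z w))| * enorm d
  / (enorm (cross d e) * enorm (cross d e')).

(** Both planes contain the chord [c z - c y], and the difference of their
    second divided differences is a third divided difference. *)
Lemma plane_angleE x y z w : x < y -> y < z -> z < w ->
  cross (divdiff1 c y z) (divdiff2 c x y z) != 0 ->
  cross (divdiff1 c y z) (divdiff2 c y z w) != 0 ->
  plane_angle x y z w = asin ((w - x) * plane_angle_rate x y z w).
Proof.
move=> xy yz zw n0 n1; have xw := lt_trans (lt_trans xy yz) zw.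
rewrite /plane_angle cross_chordsl// cross_chordsr// !normalizeZ; first last.
- by rewrite !mulr_gt0// subr_gt0// (lt_trans xy).
- by rewrite !mulr_gt0// subr_gt0// (lt_trans yz).
rewrite dRP2_asin ?enorm_normalize//; congr asin.
rewrite /plane_angle_rate.
set d := divdiff1 c y z in n0 n1 *; set e := divdiff2 c x y z in n0 *.
set e' := divdiff2 c y z w in n1 *.
have e'E : e' = (w - x) *: divdiff3 c x y z w + e.
  by rewrite /divdiff3 scalerA mulfV ?scale1r ?subrK// subr_eq0 gt_eqF.
clearbody d e e'; rewrite /normalize crossZl crossZr cross_crossl.
rewrite !enormZ !normfV !(ger0_norm (enorm_ge0 _)).
have -> : dot d (cross e e') = (w - x) * dot d (cross e (divdiff3 c x y z w)).
  rewrite e'E dot3E (dot3E _ (cross _ (divdiff3 _ _ _ _ _))).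
  by rewrite !(cross3E, mxE); ring.
rewrite normrM (gtr0_norm (x := w - x)) ?subr_gt0// invfM; ring.
Qed.

End OsculatingPlanes.

Lemma scale_pos_neq0 (R : realType) (a : R) (u : 'rV[R]_3) :
  0 < a -> u != 0 -> a *: u != 0.
Proof. by move=> a0 u0; rewrite scaler_eq0 negb_or u0 gt_eqF. Qed.

Section TorsionDensity.
Variable R : realType.

(** In terms of the first three derivatives of a curve, [|tau| * |c'|]. *)
Definition torsion_density (d1 d2 d3 : 'rV[R]_3) : R :=
  `|dot d1 (cross d2 d3)| * enorm d1 / enorm (cross d1 d2) ^+ 2.

Lemma cvg_torsion_density (T : Type) (F : set_system T) {FF : Filter F}
    (u v w : T -> 'rV[R]_3) a b d : cross a b != 0 ->
  u t @[t --> F] --> a -> v t @[t --> F] --> b -> w t @[t --> F] --> d ->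
  torsion_density (u t) (v t) (w t) @[t --> F] --> torsion_density a b d.
Proof.
move=> ab0 ua vb wd; apply: cvgM.
  apply: cvgM; last exact: cvg_enorm.
  by apply: cvg_norm; apply: cvg_dot => //; exact: cvg_cross.
apply: cvgV; first by rewrite sqrf_eq0 enorm_eq0.
by rewrite expr2; under eq_fun do rewrite expr2; apply: cvgM;
  apply: cvg_enorm; exact: cvg_cross.
Qed.

End TorsionDensity.

Section Uniformity.
Variables (R : realType) (A B : R).

(** The Lebesgue number lemma for properties of subintervals. *)
Lemma uniform_on_segment (P : R -> R -> Prop) :
  (forall s, s \in `[A, B] -> exists2 d, 0 < d & forall x w,
     A <= x -> x < w -> w <= B -> `|x - s| < d -> `|w - s| < d -> P x w) ->
  exists2 d, 0 < d & forall x w,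
     A <= x -> x < w -> w <= B -> w - x < d -> P x w.
Proof.
move=> loc.
have /compact_near_coveringP/near_covering_withinP := @segment_compact R A B.
move=> /(_ _ (0^'+) (fun d x => forall w, x < w -> w <= B -> w - x < d -> P x w)).
have loc' x : x \in `[A, B] -> \forall x' \near x & d \near (0 : R)^'+,
    x' \in `[A, B] -> forall w, x' < w -> w <= B -> w - x' < d -> P x' w.
  move=> /loc[d d0 Pd].
  exists (ball x (d / 2), [set e | e < d / 2]) => /=.
    split; first by apply: nbhsx_ballx; rewrite divr_gt0.
    by apply: nbhs_right_lt; rewrite divr_gt0.
  move=> [x' e] /= [xx' ed]; rewrite in_itv/= => /andP[Ax' x'B] w x'w wB wx'.
  move: xx'; rewrite /ball/= => xx'.
  apply: Pd => //; move: xx'; rewrite !ltr_norml => /andP[? ?];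
    by apply/andP; split; lra.
move=> /(_ _ loc') H.
have near_ex (Q : set R) : (\forall e \near 0^'+, Q e) -> exists2 d, 0 < d & Q d.
  move=> [e /= e0 Qe]; exists (e / 2); first by rewrite divr_gt0.
  apply: Qe; last by rewrite divr_gt0.
  by rewrite /ball_/= sub0r normrN gtr0_norm ?divr_gt0// ltr_pdivrMr// ltr_pMr// ltr1n.
have [d d0 Qd] := near_ex _ H; exists d => // x w Ax xw wB wx.
by apply: Qd => //; rewrite /= in_itv/= Ax (le_trans (ltW xw)).
Qed.

(** The filter along which all four points tend to [s], since the outer ones do. *)
Definition increasing4 (s : R) : set_system (R * R * R * R) :=
  filter_from [set d : R | 0 < d] (fun d => [set t |
    [/\ A <= t.1.1.1, t.1.1.1 < t.1.1.2, t.1.1.2 < t.1.2, t.1.2 < t.2 & t.2 <= B]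
    /\ `|t.1.1.1 - s| < d /\ `|t.2 - s| < d]).

Global Instance increasing4_filter s : Filter (increasing4 s).
Proof.
apply: filter_from_filter; first by exists 1; rewrite /=.
move=> d e /= d0 e0; exists (Num.min d e); first by rewrite /= lt_min d0.
by move=> t /= [ho []]; rewrite !lt_min => /andP[? ?] /andP[? ?].
Qed.

Lemma increasing4_fst s : t.1.1.1 @[t --> increasing4 s] --> s.
Proof. by apply/cvgrPdist_lt => e e0; exists e => // t [_ [h _]]; rewrite distrC. Qed.

Lemma increasing4_snd s : t.2 @[t --> increasing4 s] --> s.
Proof. by apply/cvgrPdist_lt => e e0; exists e => // t [_ [_ h]]; rewrite distrC. Qed.

Lemma increasing4_ordered s : \forall t \near increasing4 s,
  [/\ A <= t.1.1.1, t.1.1.1 < t.1.1.2, t.1.1.2 < t.1.2, t.1.2 < t.2 & t.2 <= B].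
Proof. by exists 1 => [|t []] //=. Qed.

(** Compactness turns a limit at every point of the diagonal into one threshold
    for all quadruples. *)
Lemma uniform_increasing4 (P : R -> R -> R -> R -> Prop) :
  (forall s, s \in `[A, B] ->
     \forall t \near increasing4 s, P t.1.1.1 t.1.1.2 t.1.2 t.2) ->
  exists2 d, 0 < d & forall x y z w,
    A <= x -> x < y -> y < z -> z < w -> w <= B -> w - x < d -> P x y z w.
Proof.
move=> loc.
have [|d d0 Pd] := @uniform_on_segment
  (fun x w => forall y z, x < y -> y < z -> z < w -> P x y z w).
  move=> s sAB; have [d d0 Pd] := loc s sAB.
  exists d => // x w Ax xw wB xd wd y z xy yz zw.
  exact: (Pd (x, y, z, w)).
exists d => // x y z w Ax xy yz zw wB wx.
by apply: (Pd x w) => //; exact: lt_trans (lt_trans xy yz) zw.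
Qed.

End Uniformity.

Section PlaneAngleLimit.
Variables (R : realType) (A B : R) (c : nat -> R -> 'rV[R]_3).
Hypothesis c_derive : forall i k, (i < 3)%N ->
  derivative_on A B (fun t => c i t 0 k) (fun t => c i.+1 t 0 k).
Hypothesis c3_continuous : forall k, {within `[A, B], continuous (fun t => c 3 t 0 k)}.
Hypothesis c_regular : forall s, s \in `[A, B] -> cross (c 1 s) (c 2 s) != 0.

Let g s := torsion_density (c 1 s) (c 2 s) (c 3 s).
Variable G : R -> R.
Hypothesis G_derive : derivative_on A B G g.

Lemma chain_continuous i k : (i <= 3)%N ->
  {within `[A, B], continuous (fun t => c i t 0 k)}.
Proof.
rewrite leq_eqVlt => /orP[/eqP ->|i3]; first exact: c3_continuous.
exact: (c_derive k i3).1.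
Qed.

Lemma torsion_density_continuous : {within `[A, B], continuous g}.
Proof.
apply/subspace_continuousP => s sAB.
by apply: cvg_torsion_density; first exact: c_regular; apply: cvg_rV => k;
  apply: (iffLR (subspace_continuousP _ _) (chain_continuous _)).
Qed.

Section AlongFilter.
Variables (T : Type) (F : set_system T) (x y z w : T -> R) (s : R).
Context {FF : Filter F}.
Hypothesis sAB : s \in `[A, B].
Hypotheses (xs : x t @[t --> F] --> s) (ws : w t @[t --> F] --> s).
Hypothesis ordered : \forall t \near F,
  [/\ A <= x t, x t < y t, y t < z t, z t < w t & w t <= B].

Let within_AB : \forall t \near F, A <= x t /\ w t <= B.
Proof. by apply: filterS ordered => t []. Qed.

Lemma cvg_divdiff1_yz : divdiff1 (c 0) (y t) (z t) @[t --> F] --> c 1 s.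
Proof.
apply: cvg_rV => k.
apply: (cvg_mean (@chain_continuous 1 k isT) sAB xs ws within_AB).
apply: filterS ordered => t [Ax xy yz zw wB].
have [||xi /andP[x1 x2] e] := divdiff1_mean (@c_derive 0 k isT) _ yz _.
- exact: le_trans Ax (ltW xy).
- exact: le_trans (ltW zw) wB.
exists xi; first by rewrite (le_trans (ltW xy) x1) (le_trans x2 (ltW zw)).
by rewrite -e !mxE.
Qed.

Lemma cvg_divdiff2_xyz :
  divdiff2 (c 0) (x t) (y t) (z t) @[t --> F] --> 2^-1 *: c 2 s.
Proof.
apply: cvg_rV => k; rewrite mxE mulrC.
have c2 : {within `[A, B], continuous (fun t => c 2 t 0 k / 2)}.
  by move=> t; apply: cvgM; [exact: chain_continuous|exact: cvg_cst].
apply: (cvg_mean c2 sAB xs ws within_AB).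
apply: filterS ordered => t [Ax xy yz zw wB].
have [|xi /andP[x1 x2] e] :=
  divdiff2_mean (@c_derive 0 k isT) (@c_derive 1 k isT) Ax xy yz _.
- exact: le_trans (ltW zw) wB.
exists xi; first by rewrite x1 (le_trans x2 (ltW zw)).
by rewrite -e !mxE.
Qed.

Lemma cvg_divdiff2_yzw :
  divdiff2 (c 0) (y t) (z t) (w t) @[t --> F] --> 2^-1 *: c 2 s.
Proof.
apply: cvg_rV => k; rewrite mxE mulrC.
have c2 : {within `[A, B], continuous (fun t => c 2 t 0 k / 2)}.
  by move=> t; apply: cvgM; [exact: chain_continuous|exact: cvg_cst].
apply: (cvg_mean c2 sAB xs ws within_AB).
apply: filterS ordered => t [Ax xy yz zw wB].
have [|xi /andP[x1 x2] e] :=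
  divdiff2_mean (@c_derive 0 k isT) (@c_derive 1 k isT) _ yz zw wB.
- exact: le_trans Ax (ltW xy).
exists xi; first by rewrite x2 (le_trans (ltW xy) x1).
by rewrite -e !mxE.
Qed.

Lemma cvg_divdiff3 :
  divdiff3 (c 0) (x t) (y t) (z t) (w t) @[t --> F] --> 6^-1 *: c 3 s.
Proof.
apply: cvg_rV => k; rewrite mxE mulrC.
have c3 : {within `[A, B], continuous (fun t => c 3 t 0 k / 6)}.
  by move=> t; apply: cvgM; [exact: chain_continuous|exact: cvg_cst].
apply: (cvg_mean c3 sAB xs ws within_AB).
apply: filterS ordered => t [Ax xy yz zw wB].
have [xi xiP e] := divdiff3_mean (@c_derive 0 k isT) (@c_derive 1 k isT)
  (@c_derive 2 k isT) Ax xy yz zw wB.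
by exists xi => //; rewrite -e !mxE.
Qed.

Let cross_half_neq0 : cross (c 1 s) (2^-1 *: c 2 s) != 0.
Proof. by rewrite crossZr scaler_eq0 negb_or invr_eq0 pnatr_eq0/= c_regular. Qed.

Let near_neq0 (u : T -> 'rV[R]_3) :
  u t @[t --> F] --> 2^-1 *: c 2 s ->
  \forall t \near F, cross (divdiff1 (c 0) (y t) (z t)) (u t) != 0.
Proof.
move=> us; have h : enorm (cross (divdiff1 (c 0) (y t) (z t)) (u t)) @[t --> F]
    --> enorm (cross (c 1 s) (2^-1 *: c 2 s)).
  by apply: cvg_enorm; apply: cvg_cross; [exact: cvg_divdiff1_yz|exact: us].
near=> t; rewrite -enorm_gt0; near: t.
by apply: (cvgr_gt _ h); rewrite enorm_gt0.
Unshelve. all: by end_near. Qed.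

Lemma near_chords_neq0 : \forall t \near F,
  cross (c 0 (y t) - c 0 (x t)) (c 0 (z t) - c 0 (y t)) != 0 /\
  cross (c 0 (z t) - c 0 (y t)) (c 0 (w t) - c 0 (z t)) != 0.
Proof.
have n1 := near_neq0 cvg_divdiff2_xyz; have n2 := near_neq0 cvg_divdiff2_yzw.
move: ordered n1 n2; apply: filterS3 => t [Ax xy yz zw wB] n1 n2.
have [yx0 zy0 wz0] : [/\ 0 < y t - x t, 0 < z t - y t & 0 < w t - z t].
  by rewrite !subr_gt0.
have zx0 : 0 < z t - x t by rewrite subr_gt0 (lt_trans xy).
have wy0 : 0 < w t - y t by rewrite subr_gt0 (lt_trans yz).
split; [rewrite cross_chordsl//|rewrite cross_chordsr//].
  by apply: scale_pos_neq0 n1; do 2?apply: mulr_gt0.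
by apply: scale_pos_neq0 n2; do 2?apply: mulr_gt0.
Qed.

Lemma cvg_plane_angle_rate :
  plane_angle_rate (c 0) (x t) (y t) (z t) (w t) @[t --> F] --> g s / 3.
Proof.
have -> : g s / 3 =
  `|dot (c 1 s) (cross (2^-1 *: c 2 s) (6^-1 *: c 3 s))| * enorm (c 1 s)
  / (enorm (cross (c 1 s) (2^-1 *: c 2 s)) * enorm (cross (c 1 s) (2^-1 *: c 2 s))).
  rewrite /g /torsion_density !(crossZl, crossZr) !dotZr !normrM !enormZ.
  rewrite !normfV !normr_nat; field.
  by rewrite enorm_eq0 c_regular.
apply: cvgM.
  apply: cvgM; last by apply: cvg_enorm; exact: cvg_divdiff1_yz.
  apply: cvg_norm; apply: cvg_dot; first exact: cvg_divdiff1_yz.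
  by apply: cvg_cross; [exact: cvg_divdiff2_xyz|exact: cvg_divdiff3].
apply: cvgV; first by rewrite mulf_neq0// enorm_eq0.
apply: cvgM; apply: cvg_enorm.
  by apply: cvg_cross; [exact: cvg_divdiff1_yz|exact: cvg_divdiff2_xyz].
by apply: cvg_cross; [exact: cvg_divdiff1_yz|exact: cvg_divdiff2_yzw].
Qed.

Lemma cvg_plane_angle :
  plane_angle (c 0) (x t) (y t) (z t) (w t) / (w t - x t) @[t --> F] --> g s / 3.
Proof.
have wx0 : w t - x t @[t --> F] --> 0 by rewrite -(subrr s); exact: cvgB.
apply: cvg_trans (cvg_asin_over wx0 cvg_plane_angle_rate _); last first.
  apply: filterS ordered => t [Ax xy yz zw wB].
  rewrite subr_gt0 (lt_trans (lt_trans xy yz))//; split=> //.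
  by rewrite /plane_angle_rate divr_ge0 ?mulr_ge0 ?normr_ge0 ?enorm_ge0.
apply: near_eq_cvg.
have n1 := near_neq0 cvg_divdiff2_xyz; have n2 := near_neq0 cvg_divdiff2_yzw.
move: ordered n1 n2; apply: filterS3 => t [Ax xy yz zw wB] n1 n2.
by rewrite plane_angleE.
Qed.

Lemma cvg_primitive_slope : (G (w t) - G (x t)) / (w t - x t) @[t --> F] --> g s.
Proof.
apply: (cvg_mean torsion_density_continuous sAB xs ws within_AB).
apply: filterS ordered => t [Ax xy yz zw wB].
have xw := lt_trans (lt_trans xy yz) zw.
have [xi /andP[x1 x2] ->] := mean_value G_derive Ax xw wB.
exists xi; first by rewrite !ltW.
by rewrite mulfK// subr_eq0 gt_eqF.
Qed.

End AlongFilter.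

(** The left-hand side divided by [w - x] has limit 0 at every point of the
    diagonal, since both terms tend to [g s / 3]. *)
Theorem plane_angle_uniform (eps : R) : 0 < eps ->
  exists2 d, 0 < d & forall x y z w : R,
    A <= x -> x < y -> y < z -> z < w -> w <= B -> w - x < d ->
    [/\ cross (c 0 y - c 0 x) (c 0 z - c 0 y) != 0,
        cross (c 0 z - c 0 y) (c 0 w - c 0 z) != 0 &
        `|plane_angle (c 0) x y z w - (G w - G x) / 3| <= eps * (w - x)].
Proof.
move=> eps0; apply: uniform_increasing4 => s sAB.
have xs := @increasing4_fst _ A B s; have ws := @increasing4_snd _ A B s.
have ordered := @increasing4_ordered _ A B s.
have lim0 : plane_angle (c 0) t.1.1.1 t.1.1.2 t.1.2 t.2 / (t.2 - t.1.1.1)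
    - (G t.2 - G t.1.1.1) / (t.2 - t.1.1.1) / 3 @[t --> increasing4 A B s] --> 0.
  rewrite -(subrr (g s / 3)); apply: cvgB; first exact: cvg_plane_angle.
  apply: cvgM; last exact: cvg_cst.
  by apply: cvg_primitive_slope; [exact: sAB|exact: xs|exact: ws|exact: ordered].
have chords : \forall t \near increasing4 A B s,
    cross (c 0 t.1.1.2 - c 0 t.1.1.1) (c 0 t.1.2 - c 0 t.1.1.2) != 0 /\
    cross (c 0 t.1.2 - c 0 t.1.1.2) (c 0 t.2 - c 0 t.1.2) != 0.
  exact: (near_chords_neq0 sAB xs ws ordered).
move/cvgrPdist_le : lim0 => /(_ _ eps0) small; move: small ordered chords.
apply: filterS3 => t + [Ax xy yz zw wB] [n1 n2].
have wx : 0 < t.2 - t.1.1.1 by rewrite subr_gt0 (lt_trans (lt_trans xy yz)).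
rewrite sub0r normrN -(ler_pM2r wx) -[X in _ * X <= _](gtr0_norm wx) -normrM.
move=> h; split=> //; move: h; congr (`|_| <= _); field; by rewrite gt_eqF.
Qed.

(** The slope [divdiff1 (c 0) y z] tends to a unit vector, hence has norm at
    least 1/2 in a short enough interval. *)
Lemma chord_lower_bound : (forall s, s \in `[A, B] -> enorm (c 1 s) = 1) ->
  exists2 d, 0 < d & forall x y z w : R,
    A <= x -> x < y -> y < z -> z < w -> w <= B -> w - x < d ->
    (z - y) / 2 <= enorm (c 0 z - c 0 y).
Proof.
move=> c_unit; apply: (uniform_increasing4
  (P := fun _ y z _ => (z - y) / 2 <= enorm (c 0 z - c 0 y))) => s sAB.
have xs := @increasing4_fst _ A B s; have ws := @increasing4_snd _ A B s.
have ordered := @increasing4_ordered _ A B s.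
have h : enorm (divdiff1 (c 0) t.1.1.2 t.1.2) @[t --> increasing4 A B s] --> (1 : R).
  rewrite -(c_unit s sAB); apply: cvg_enorm.
  exact: (cvg_divdiff1_yz sAB xs ws ordered).
have big : \forall t \near increasing4 A B s,
    1 / 2 < enorm (divdiff1 (c 0) t.1.1.2 t.1.2).
  by apply: (cvgr_gt _ h); lra.
move: big ordered; apply: filterS2 => t + [Ax xy yz zw wB].
have zy : 0 < t.1.2 - t.1.1.2 by rewrite subr_gt0.
by rewrite enormZ normfV gtr0_norm// ltr_pdivlMl// mul1r => /ltW.
Qed.

End PlaneAngleLimit.

(** * Derivatives within a segment *)

Section FirstOrder.
Variable R : realType.
Implicit Types (A B L x y s : R) (f df c : R -> 'rV[R]_3) (k : 'I_3).

(** An epsilon-delta form of [df] being the derivative of [f] within the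
    segment, end points included, which can be checked piecewise. *)
Definition first_order A B f df := forall x, x \in `[A, B] -> forall e, 0 < e ->
  exists2 d, 0 < d & forall y, y \in `[A, B] -> `|y - x| < d ->
    `|f y - f x - (y - x) *: df x| <= e * `|y - x|.

Lemma first_order_deriv_in A B f :
  (forall x, x \in `[A, B] -> derivable_in A B f x) ->
  first_order A B f (deriv_in A B f).
Proof.
move=> f' x xAB e e0; have /cvgrPdist_le/(_ e e0) := f' x xAB.
move=> [d /= d0 fd]; exists d => // y yAB yx.
have [->|yx0] := eqVneq y x; first by rewrite !subrr scale0r subrr !normr0 mulr0.
have := fd y; rewrite /ball_/= distrC => /(_ yx yx0 yAB).
have y0 : 0 < `|y - x| by rewrite normr_gt0 subr_eq0.
rewrite -(ler_pM2r y0); apply: le_trans.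
rewrite mulrC -normrZ scalerBr /diff_quot scalerA mulfV ?subr_eq0//.
by rewrite scale1r distrC.
Qed.

Lemma first_order_coord A B f df k : first_order A B f df ->
  derivative_on A B (fun x => f x 0 k) (fun x => df x 0 k).
Proof.
move=> f'.
have f'k x : x \in `[A, B] -> forall e, 0 < e -> exists2 d, 0 < d &
    forall y, y \in `[A, B] -> `|y - x| < d ->
      `|f y 0 k - f x 0 k - (y - x) * df x 0 k| <= e * `|y - x|.
  move=> xAB e e0; have [d d0 fd] := f' x xAB e e0.
  exists d => // y yAB yx; apply: le_trans (fd y yAB yx).
  rewrite [leRHS]mx_normrE; apply: le_trans (le_bigmax _ _ (0, k)).
  by rewrite !mxE.
split.
  apply/subspace_continuousP => x xAB; apply/cvgrPdist_le => e e0.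
  have [d d0 fd] := f'k x xAB 1 ltr01.
  pose M := 1 + `|df x 0 k|; have M0 : 0 < M by rewrite ltr_wpDr.
  exists (Num.min d (e / M)); first by rewrite /= lt_min d0 divr_gt0.
  move=> y; rewrite /ball_/= lt_min distrC => /andP[yd ye] yAB.
  rewrite distrC; apply: le_trans (_ : `|y - x| * M <= _); last first.
    by rewrite -ler_pdivlMr// ltW.
  rewrite -(subrK ((y - x) * df x 0 k) (_ - _)) (le_trans (ler_normD _ _))//.
  by rewrite mulrDr lerD//; [rewrite [leRHS]mulrC; exact: fd|rewrite normrM].
move=> x xAB; have xAB' : x \in `[A, B] by exact: subset_itv_oo_cc xAB.
have cv : (fun h : R => h^-1 *: (f (h *: 1 + x) 0 k - f x 0 k : R^o)) @ 0^'
    --> df x 0 k.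
  apply/cvgrPdist_le => e e0; have [d d0 fd] := f'k x xAB' e e0.
  move: xAB; rewrite in_itv/= => /andP[Ax xB].
  exists (Num.min d (Num.min (x - A) (B - x))) => /=.
    by rewrite !lt_min d0 !subr_gt0 Ax.
  move=> h; rewrite /= sub0r normrN !lt_min => /and3P[hd hA hB] h0.
  have hx : h *: 1 + x - x = h by rewrite addrK /GRing.scale/= mulr1.
  have := fd (h *: 1 + x); rewrite hx => /(_ _ hd).
  have -> : h *: 1 + x \in `[A, B].
    rewrite in_itv/= /GRing.scale/= mulr1.
    move: hA hB; rewrite !ltr_norml => /andP[? ?] /andP[? ?].
    by apply/andP; split; lra.
  move=> /(_ isT) fh; set u := f _ 0 k in fh *.
  have -> : df x 0 k - h^-1 *: (u - f x 0 k : R^o)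
      = - (h^-1 * (u - f x 0 k - h * df x 0 k)) by rewrite /GRing.scale/=; field.
  by rewrite normrN normrM normfV ler_pdivrMl ?normr_gt0// [leRHS]mulrC.
apply: DeriveDef; first exact/cvg_ex/(ex_intro _ (df x 0 k)).
exact/cvg_lim.
Qed.

(** On [[0, 2 L]] the periodic extension has one junction, at [L]. *)
Definition periodic_ext L f x := if x <= L then f x else f (x - L).

Lemma first_order_periodic_ext L f df : f 0 = f L -> df 0 = df L ->
  first_order 0 L f df ->
  first_order 0 (L + L) (periodic_ext L f) (periodic_ext L df).
Proof.
move=> f0L df0L f' x; rewrite in_itv/= => /andP[x0 x2L] e e0.
have inL y : 0 <= y -> y <= L -> y \in `[0, L] by move=> ? ?; rewrite in_itv/=; apply/andP.
have inR y : L < y -> y <= L + L -> y - L \in `[0, L].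
  by move=> ? ?; rewrite in_itv/=; apply/andP; split; lra.
rewrite /periodic_ext; have [xL|Lx|xL] := ltgtP x L.
- have [d d0 fd] := f' x (inL _ x0 (ltW xL)) e e0.
  exists (Num.min d (L - x)); first by rewrite lt_min d0 subr_gt0.
  move=> y; rewrite in_itv/= => /andP[y0 y2L]; rewrite lt_min => /andP[yd yx].
  have yL : y <= L by move: yx; rewrite ltr_norml => /andP[? ?]; lra.
  by rewrite yL; apply: fd => //; exact: inL.
- have [d d0 fd] := f' (x - L) (inR _ Lx x2L) e e0.
  exists (Num.min d (x - L)); first by rewrite lt_min d0 subr_gt0.
  move=> y; rewrite in_itv/= => /andP[y0 y2L]; rewrite lt_min => /andP[yd yx].
  have Ly : L < y by move: yx; rewrite ltr_norml => /andP[? ?]; lra.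
  have E : y - L - (x - L) = y - x by lra.
  by rewrite [y <= L]leNgt Ly/= -E; apply: fd; [exact: inR|rewrite E].
- rewrite {x}xL in x0 x2L *.
  have [d1 d10 f1] := f' L (inL _ x0 (lexx L)) e e0.
  have [d2 d20 f2] := f' 0 (inL _ (lexx 0) x0) e e0.
  exists (Num.min d1 d2); first by rewrite lt_min d10.
  move=> y; rewrite in_itv/= => /andP[y0 y2L]; rewrite lt_min => /andP[yd1 yd2].
  have [yL|Ly] := leP y L; first by apply: f1 => //; exact: inL.
  have := f2 _ (inR _ Ly y2L); rewrite subr0 -f0L -df0L; exact.
Qed.

End FirstOrder.

(** * Torsion of a unit speed curve *)

Section FilterWithin.
Variables (R : realType) (A B : R).
Hypothesis AB : A < B.

Lemma within_dnbhs_proper (x : R) : x \in `[A, B] ->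
  ProperFilter (within `[A, B] x^').
Proof.
move=> xAB; apply: Build_ProperFilter_ex => P [d /= d0 Pd].
move: (xAB); rewrite in_itv/= => /andP[Ax xB].
pose h := Num.min (d / 2) ((B - A) / 2).
have h0 : 0 < h by rewrite lt_min !divr_gt0// subr_gt0.
have hd : h < d.
  by rewrite gt_min ltr_pdivrMr// ltr_pMr// ltr1n.
have hAB : h <= (B - A) / 2 by rewrite ge_min lexx orbT.
have [xm|xm] := leP x ((A + B) / 2).
  exists (x + h); apply: Pd => /=.
  - by rewrite opprD addrA subrr sub0r normrN gtr0_norm.
  - by rewrite gt_eqF// ltrDl.
  - by rewrite in_itv/=; apply/andP; split; lra.
exists (x - h); apply: Pd => /=.
- by rewrite opprB addrCA subrr addr0 gtr0_norm.
- by rewrite lt_eqF// ltrBlDr ltrDl.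
- by rewrite in_itv/=; apply/andP; split; lra.
Qed.

Lemma cvg_within_dnbhs_id (x : R) : y @[y --> within `[A, B] x^'] --> x.
Proof. by move=> P Px; apply: cvg_within; exact: (@nbhs_dnbhs _ x). Qed.

Lemma diff_quotK (f : R -> 'rV[R]_3) x y : (y - x) *: diff_quot f x y = f y - f x.
Proof.
have [->|yx] := eqVneq y x; first by rewrite !subrr scale0r.
by rewrite /diff_quot scalerA mulfV ?scale1r// subr_eq0.
Qed.

Lemma derivable_in_continuous (f : R -> 'rV[R]_3) x : derivable_in A B f x ->
  f y @[y --> within `[A, B] x^'] --> f x.
Proof.
move=> f'; rewrite -[f x]addr0 -[X in _ + X](scale0r (deriv_in A B f x)).
rewrite -(subrr x); under eq_fun do rewrite -[f _](subrK (f x)) addrC -diff_quotK.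
apply: cvgD; first exact: cvg_cst.
apply: cvgZ => //; apply: cvgB; last exact: cvg_cst.
exact: cvg_within_dnbhs_id.
Qed.

(** [dot (f y + f x) (f y - f x)] is the difference of two squared norms, hence
    vanishes; dividing by [y - x] and letting [y] tend to [x] gives the claim, at
    the end points too. *)
Lemma unit_orthogonal (f : R -> 'rV[R]_3) x : x \in `[A, B] ->
  (forall y, y \in `[A, B] -> enorm (f y) = 1) -> derivable_in A B f x ->
  dot (f x) (deriv_in A B f x) = 0.
Proof.
move=> xAB f1 f'; have FF := within_dnbhs_proper xAB.
have lim1 : dot (f y + f x) (diff_quot f x y) @[y --> within `[A, B] x^']
    --> dot (f x + f x) (deriv_in A B f x).
  apply: cvg_dot => //; apply: cvgD; last exact: cvg_cst.
  exact: derivable_in_continuous.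
have lim0 : dot (f y + f x) (diff_quot f x y) @[y --> within `[A, B] x^'] --> (0 : R).
  apply: cvg_near_cst; near=> y; have yAB : y \in `[A, B] by near: y; exact: withinT.
  rewrite /diff_quot dotZr.
  have -> : dot (f y + f x) (f y - f x) = dot (f y) (f y) - dot (f x) (f x).
    by rewrite !dot3E !mxE; ring.
  by rewrite -!enorm_sqr !f1// subrr mulr0.
have : dot (f x + f x) (deriv_in A B f x) = 0.
  by apply: cvg_unique lim1 lim0; exact: Rhausdorff.
rewrite !dot3E !mxE => E; apply: (mulfI (x := 2)) => //; rewrite mulr0 -[RHS]E; ring.
Unshelve. all: by end_near. Qed.

End FilterWithin.

Section Torsion.
Variables (R : realType) (A B : R) (c : R -> 'rV[R]_3).
Hypothesis AB : A < B.
Hypothesis c_smooth : smooth_in A B c.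
Hypothesis c_unit : arc_length_param A B c.
Hypothesis c_ddot_neq0 : forall s, s \in `[A, B] -> derivn_in A B 2 c s != 0.

Lemma tangent_orthogonal s : s \in `[A, B] ->
  dot (derivn_in A B 1 c s) (derivn_in A B 2 c s) = 0.
Proof.
move=> sAB; apply: (unit_orthogonal AB sAB (f := derivn_in A B 1 c)).
  exact: c_unit.
exact: (@c_smooth 1%N s sAB).
 Qed.

Lemma enorm_cross_derivn s : s \in `[A, B] ->
  enorm (cross (derivn_in A B 1 c s) (derivn_in A B 2 c s)) =
  enorm (derivn_in A B 2 c s).
Proof.
move=> sAB; rewrite /enorm lagrange_identity tangent_orthogonal// expr0n/= subr0.
by rewrite -(enorm_sqr (derivn_in A B 1 c s)) (c_unit sAB) expr1n mul1r.
Qed.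

Lemma dot_subr_addr (u v : 'rV[R]_3) : dot (u - v) (u + v) = enorm u ^+ 2 - enorm v ^+ 2.
Proof. by rewrite !enorm_sqr !dot3E !mxE; ring. Qed.

Lemma scaled_diff_inv (h p q : R) : 0 < p -> 0 < q ->
  h * (p^-1 - q^-1) = - (h * (p ^+ 2 - q ^+ 2) / ((p + q) * (p * q))).
Proof. by move=> p0 q0; field; rewrite !gt_eqF// addr_gt0. Qed.

(** With [t], [a], [d] the first three derivatives, the right-hand side is what
    the product rule gives for [|a|^-1 *: cross t a], the binormal, and the left
    one is a multiple of the normal. *)
Lemma binormal_limitE (t a d : 'rV[R]_3) : 0 < enorm a -> dot t a = 0 ->
  - (dot t (cross a d) / enorm a ^+ 2) *: ((enorm a)^-1 *: a) =
  - (dot d (a + a) / ((enorm a + enorm a) * (enorm a * enorm a))) *: cross t a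
  + (enorm a)^-1 *: (cross t d + cross a a).
Proof.
move=> a0 ta.
have I : dot a a *: cross t d - dot d a *: cross t a + dot t (cross a d) *: a
    = dot t a *: cross a d.
  by apply: rV3P; rewrite !dot3E !(cross3E, mxE); ring.
have {}I : - dot t (cross a d) *: a = enorm a ^+ 2 *: cross t d - dot d a *: cross t a.
  by move: I; rewrite ta scale0r enorm_sqr => /addr0_eq I; rewrite scaleNr -I opprK.
have -> : cross a a = 0 by apply: rV3P; rewrite !(cross3E, mxE); ring.
have -> : dot d (a + a) = 2 * dot d a by rewrite !dot3E !mxE; ring.
have -> : - (dot t (cross a d) / enorm a ^+ 2) *: ((enorm a)^-1 *: a) =
    (enorm a ^+ 3)^-1 *: (- dot t (cross a d) *: a).
  by rewrite !scalerA; congr (_ *: _); field; rewrite gt_eqF.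
rewrite I addr0 scalerBr !scalerA addrC -scaleNr.
by congr (_ *: _ + _ *: _); field; rewrite ?gt_eqF ?addr_gt0.
Qed.

(** The discrete product rule for [ry *: cross ty ay]. *)
Lemma scaled_cross_diff (h ry rx : R) (ty tx ay ax : 'rV[R]_3) :
  h *: (ry *: cross ty ay - rx *: cross tx ax) =
  (h * (ry - rx)) *: cross tx ax
  + ry *: (cross ty (h *: (ay - ax)) + cross (h *: (ty - tx)) ax).
Proof. by apply: rV3P; rewrite !(cross3E, mxE); ring. Qed.

(** The product rule before passing to the limit.  The difference quotient of
    [|a|^-1] is expressed by means of that of [a], so that no derivative of a
    norm has to be taken and the end points need no special treatment. *)
Lemma binormal_diff_quot x y : 
  x \in `[A, B] -> y \in `[A, B] ->
  let t := derivn_in A B 1 c in let a := derivn_in A B 2 c in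
  diff_quot (binormal A B c) x y =
  - (dot (diff_quot a x y) (a y + a x)
     / ((enorm (a y) + enorm (a x)) * (enorm (a y) * enorm (a x))))
    *: cross (t x) (a x)
  + (enorm (a y))^-1 *: (cross (t y) (diff_quot a x y) + cross (diff_quot t x y) (a x)).
Proof.
move=> xAB yAB t a.
have ax : 0 < enorm (a x) by rewrite enorm_gt0 c_ddot_neq0.
have ay : 0 < enorm (a y) by rewrite enorm_gt0 c_ddot_neq0.
rewrite {2}/diff_quot dotZl dot_subr_addr -scaled_diff_inv// [in LHS]/diff_quot.
have bE z : binormal A B c z = (enorm (a z))^-1 *: cross (t z) (a z).
  by rewrite -crossZr.
by rewrite !bE scaled_cross_diff.
Qed.

Lemma binormal_derivative x : x \in `[A, B] ->
  let t := derivn_in A B 1 c in let a := derivn_in A B 2 c in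
  let d := derivn_in A B 3 c in
  deriv_in A B (binormal A B c) x =
  - (dot (t x) (cross (a x) (d x)) / enorm (a x) ^+ 2) *: normal A B c x.
Proof.
move=> xAB t a d; have FF := within_dnbhs_proper AB xAB.
have ax : 0 < enorm (a x) by rewrite enorm_gt0 c_ddot_neq0.
have tx : t y @[y --> within `[A, B] x^'] --> t x.
  exact/derivable_in_continuous/(@c_smooth 1%N x xAB).
have ayx : a y @[y --> within `[A, B] x^'] --> a x.
  exact/derivable_in_continuous/(@c_smooth 2%N x xAB).
have dt : diff_quot t x y @[y --> within `[A, B] x^'] --> a x.
  exact: (@c_smooth 1%N x xAB).
have da : diff_quot a x y @[y --> within `[A, B] x^'] --> d x.
  exact: (@c_smooth 2%N x xAB).
have nax := cvg_enorm ayx.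
apply: cvg_lim; first exact: norm_hausdorff.
rewrite {1}/normal /normalize binormal_limitE//; last exact: tangent_orthogonal.
pose q y := - (dot (diff_quot a x y) (a y + a x)
     / ((enorm (a y) + enorm (a x)) * (enorm (a y) * enorm (a x))))
    *: cross (t x) (a x)
  + (enorm (a y))^-1 *: (cross (t y) (diff_quot a x y) + cross (diff_quot t x y) (a x)).
have qE : {near within `[A, B] x^', q =1 diff_quot (binormal A B c) x}.
  near=> y; rewrite /q binormal_diff_quot//.
  by near: y; exact: withinT.
apply: cvg_trans (@near_eq_cvg _ _ _ _ _ _ qE) _.
apply: cvgD; apply: cvgZ; [|exact: cvg_cst| |].
- apply: cvgN; apply: cvgM.
    by apply: cvg_dot; [exact: da|apply: cvgD; [exact: ayx|exact: cvg_cst]].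
  apply: cvgV; first by rewrite gt_eqF// !mulr_gt0 ?addr_gt0.
  by apply: cvgM; [apply: cvgD|apply: cvgM]; [exact: nax|exact: cvg_cst|exact: nax|exact: cvg_cst].
- by apply: cvgV; [rewrite gt_eqF|exact: nax].
- by apply: cvgD; apply: cvg_cross; [exact: tx|exact: da|exact: dt|exact: cvg_cst].
Unshelve. all: by end_near. Qed.

(** The normal does not vanish, so [binormal_derivative] determines the scalar
    in the definition of the torsion. *)
Theorem norm_torsion s : s \in `[A, B] ->
  `|torsion A B c s| = torsion_density
    (derivn_in A B 1 c s) (derivn_in A B 2 c s) (derivn_in A B 3 c s).
Proof.
move=> sAB; have := binormal_derivative sAB => /=.
set k := (_ / _) => bk.
have n0 : normal A B c s != 0.
  by rewrite -enorm_eq0 enorm_normalize ?oner_eq0//; exact: c_ddot_neq0.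
have tk : deriv_in A B (binormal A B c) s = - torsion A B c s *: normal A B c s.
  rewrite /torsion; exact: (@xgetPex _ 0
    [set k : R | deriv_in A B (binormal A B c) s = - k *: normal A B c s]
    (ex_intro _ k bk)).
have /eqP : (torsion A B c s - k) *: normal A B c s = 0.
  by rewrite scalerBl -[torsion _ _ _ _]opprK scaleNr -tk bk scaleNr opprK subrr.
rewrite scaler_eq0 (negbTE n0) orbF subr_eq0 => /eqP ->.
rewrite /torsion_density enorm_cross_derivn// c_unit// mulr1 /k normrM normfV.
by rewrite (ger0_norm (sqr_ge0 (enorm _))).
Qed.

End Torsion.

(** * Sums of angles of fine polygonals *)

Section Primitive.
Variables (R : realType) (A B : R) (g : R -> R).

Lemma primitive_exists : A < B -> {within `[A, B], continuous g} ->
  exists2 G : R -> R, derivative_on A B G g & G A = 0 /\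
    forall x, x \in `[A, B] ->
      (\int[lebesgue_measure]_(t in `[A, x]) (g t)%:E)%E = (G x)%:E.
Proof.
move=> AB cg.
have ig : lebesgue_measure.-integrable `[A, B] (EFin \o g).
  exact: continuous_compact_integrable (@segment_compact _ _ _) cg.
exists (fun x => \int[lebesgue_measure]_(t in `[A, x]) g t).
  split; first exact: parameterized_integral_continuous (ltW AB) ig.
  have [cg' _ _] := (continuous_within_itvP _ AB).1 cg.
  move=> x xAB; have := xAB; rewrite in_itv/= => /andP[Ax xB].
  have [dG G'] := continuous_FTC1_closed xB ig Ax (cg' x xAB).
  by apply: DeriveDef; [exact: dG|rewrite -derive1E; exact: G'].
split; first by rewrite set_itv1 Rintegral_set1.
move=> x; rewrite in_itv/= => /andP[Ax xB].
rewrite /Rintegral fineK//; apply: integrable_fin_num => //.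
by apply: integrableS ig => //; apply: subset_itvl; rewrite bnd_simp.
Qed.

End Primitive.

Section Telescope.
Variable R : realType.

(** Differences over three steps telescope to three terms at each end. *)
Lemma telescope_sum3 (H : nat -> R) m :
  \sum_(i < m) (H i.+3 - H i) = H m + H m.+1 + H m.+2 - (H 0%N + H 1%N + H 2%N).
Proof.
elim: m => [|m ih]; first by rewrite big_ord0 subrr.
by rewrite big_ord_recr/= ih; ring.
Qed.

Lemma sum_near_telescope3 (theta x : nat -> R) (G : R -> R) m e :
  (forall i, (i < m)%N ->
    `|theta i - (G (x i.+3) - G (x i)) / 3| <= e * (x i.+3 - x i)) ->
  `|\sum_(i < m) theta i -
     (G (x m) + G (x m.+1) + G (x m.+2) - (G (x 0%N) + G (x 1%N) + G (x 2%N))) / 3| <=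
  e * (x m + x m.+1 + x m.+2 - (x 0%N + x 1%N + x 2%N)).
Proof.
move=> h; rewrite -(telescope_sum3 (G \o x)) -(telescope_sum3 x).
rewrite mulr_suml mulr_sumr -sumrB (le_trans (ler_norm_sum _ _ _))//.
by apply: ler_sum => i _; exact: h.
Qed.

End Telescope.

Lemma three_steps_lt (R : realType) (a b c d r : R) :
  b - a < r / 3 -> c - b < r / 3 -> d - c < r / 3 -> d - a < r.
Proof. by move=> *; lra. Qed.

(** Here [a, b, c] are values of the primitive near [L], and [u, v, w] values
    near 0. *)
Lemma close_to_telescope (R : realType) (S I a b c u v w e : R) :
  `|S - (a + b + c - (u + v + w)) / 3| <= e / 3 ->
  `|u| <= e / 3 -> `|v| <= e / 3 -> `|w| <= e / 3 ->
  `|I - a| <= e / 3 -> `|I - b| <= e / 3 -> `|I - c| <= e / 3 -> `|S - I| <= e.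
Proof.
rewrite !ler_norml => /andP[? ?] /andP[? ?] /andP[? ?] /andP[? ?] /andP[? ?].
by move=> /andP[? ?] /andP[? ?]; apply/andP; split; lra.
Qed.

Section DiscreteBinormals.
Variable R : realType.

(** At a corner where two consecutive segments are independent the discrete
    binormal is the normal of their plane, so the distance between two such
    binormals is a [plane_angle]. *)
Lemma sum_dRP2_discrete_binormal (v : nat -> 'rV[R]_3) J (c : R -> 'rV[R]_3) x m :
  (forall i, (i <= m.+2)%N -> v i = c (x i)) ->
  (forall i, (i < m)%N ->
    cross (c (x i.+1) - c (x i)) (c (x i.+2) - c (x i.+1)) != 0 /\
    cross (c (x i.+2) - c (x i.+1)) (c (x i.+3) - c (x i.+2)) != 0) ->
  \sum_(2 <= i < m.+2) dRP2 (discrete_binormal v J i.-1) (discrete_binormal v J i) =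
  \sum_(i < m) plane_angle c (x i) (x i.+1) (x i.+2) (x i.+3).
Proof.
move=> vc nz; rewrite big_add1 big_add1/= big_mkord; apply: eq_bigr => i _.
have [n1 n2] := nz _ (ltn_ord i).
rewrite /plane_angle /= /segment/= !vc ?n1 ?n2//; have := ltn_ord i; lia.
Qed.

Lemma discard_repeated_id (T : eqType) (w : seq T) :
  sorted (fun a b => a != b) w -> discard_repeated w = w.
Proof.
elim: w => [|a [|b w] ih] // /andP[/negbTE ab sw].
by rewrite -[in RHS](ih sw) /= ab.
Qed.

End DiscreteBinormals.

Section FinePartitions.
Variables (R : realType) (L M : R) (c : nat -> R -> 'rV[R]_3).
Hypotheses (L_gt0 : 0 < L) (LM : L <= M).
Hypothesis c_derive : forall i k, (i < 3)%N ->
  derivative_on 0 M (fun t => c i t 0 k) (fun t => c i.+1 t 0 k).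
Hypothesis c3_continuous : forall k, {within `[0, M], continuous (fun t => c 3 t 0 k)}.
Hypothesis c_regular : forall s, s \in `[0, M] -> cross (c 1 s) (c 2 s) != 0.

Let g s := torsion_density (c 1 s) (c 2 s) (c 3 s).
Let I : R := fine (\int[lebesgue_measure]_(s in `[0%R, L]) (g s)%:E)%E.

(** The last sample points [x m], [x m.+1], [x m.+2] straddle [L] both for an
    open polygonal, which has [x m.+2 = L], and for a closed one, which has
    [x m = L] and goes on beyond [L] for two more segments. *)
Theorem sum_plane_angle_cvg (eps : R) : 0 < eps ->
  exists2 d, 0 < d & forall m (x : nat -> R),
    x 0%N = 0 -> x m <= L -> L <= x m.+2 -> x m.+2 <= M ->
    (forall i, (i < m.+2)%N -> 0 < x i.+1 - x i < d) ->
    (forall i, (i < m)%N ->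
      cross (c 0 (x i.+1) - c 0 (x i)) (c 0 (x i.+2) - c 0 (x i.+1)) != 0 /\
      cross (c 0 (x i.+2) - c 0 (x i.+1)) (c 0 (x i.+3) - c 0 (x i.+2)) != 0) /\
    `|\sum_(i < m) plane_angle (c 0) (x i) (x i.+1) (x i.+2) (x i.+3) - I| <= eps.
Proof.
move=> eps0; have M0 : 0 < M := lt_le_trans L_gt0 LM.
have cg : {within `[0, M], continuous g}.
  exact: torsion_density_continuous c_derive c3_continuous c_regular.
have [G G' [G0 GI]] := primitive_exists M0 cg.
have GL : G L = I by rewrite /I GI ?in_itv/= ?LM ?ltW.
(* The errors sum to at most [eps / (9 M)] times the three final points, each at
   most [M], which leaves [2 eps / 3] for the two ends. *)
have e0 : 0 < eps / (9 * M) by rewrite divr_gt0 ?mulr_gt0.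
have [d d0 dP] := plane_angle_uniform c_derive c3_continuous c_regular G' e0.
have cG s : s \in `[0, M] -> exists2 r, 0 < r &
    forall y, y \in `[0, M] -> `|s - y| < r -> `|G s - G y| <= eps / 3.
  move=> sM; have /subspace_continuousP/(_ s sM)/cvgrPdist_le := G'.1.
  move=> /(_ (eps / 3)) []; first by rewrite divr_gt0.
  by move=> r /= r0 rP; exists r => // y yM sy; exact: rP.
have [|r0 r00 r0P] := cG 0; first by rewrite in_itv/= lexx ltW.
have [|r1 r10 r1P] := cG L; first by rewrite in_itv/= LM ltW.
exists (Num.min (d / 3) (Num.min (r0 / 3) (r1 / 3))).
  by rewrite !lt_min !divr_gt0.
move=> m x x0 xmL Lxm xmM step.
have step' i : (i < m.+2)%N ->
    [/\ x i < x i.+1, x i.+1 - x i < d / 3,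
        x i.+1 - x i < r0 / 3 & x i.+1 - x i < r1 / 3].
  by move=> /step; rewrite subr_gt0 !lt_min => /andP[-> /and3P[]].
have x_mono i j : (i <= j)%N -> (j <= m.+2)%N -> x i <= x j.
  elim: j => [|j ih]; first by rewrite leqn0 => /eqP ->.
  rewrite leq_eqVlt => /orP[/eqP -> //|ij] jm.
  by have [/ltW h _ _ _] := step' j jm; exact: le_trans (ih ij (ltnW jm)) h.
have x_ge0 i : (i <= m.+2)%N -> 0 <= x i by move=> im; rewrite -x0 x_mono.
have x_leM i : (i <= m.+2)%N -> x i <= M.
  by move=> im; exact: le_trans (x_mono _ _ im (leqnn _)) xmM.
have quad i : (i < m)%N ->
  [/\ cross (c 0 (x i.+1) - c 0 (x i)) (c 0 (x i.+2) - c 0 (x i.+1)) != 0,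
      cross (c 0 (x i.+2) - c 0 (x i.+1)) (c 0 (x i.+3) - c 0 (x i.+2)) != 0 &
      `|plane_angle (c 0) (x i) (x i.+1) (x i.+2) (x i.+3)
        - (G (x i.+3) - G (x i)) / 3| <= eps / (9 * M) * (x i.+3 - x i)].
  move=> im.
  have [a1 a2 _ _] := step' i (leqW (leqW im)).
  have [b1 b2 _ _] := step' i.+1 (leqW im).
  have [c1 c2 _ _] := step' i.+2 im.
  have len : x i.+3 - x i < d by exact: three_steps_lt a2 b2 c2.
  have im1 : (i <= m.+2)%N by exact: leqW (leqW (ltnW im)).
  exact: (dP _ _ _ _ (x_ge0 _ im1) a1 b1 c1 (x_leM i.+3 im) len).
split; first by move=> i /quad[].
have quad' i : (i < m)%N -> `|plane_angle (c 0) (x i) (x i.+1) (x i.+2) (x i.+3)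
    - (G (x i.+3) - G (x i)) / 3| <= eps / (9 * M) * (x i.+3 - x i).
  by move=> /quad[].
have := sum_near_telescope3
  (theta := fun i => plane_angle (c 0) (x i) (x i.+1) (x i.+2) (x i.+3)) quad'.
set S := \sum_(i < m) _.
have le_m0 : (m <= m.+2)%N := leqW (leqnSn m).
have le_m1 : (m.+1 <= m.+2)%N := leqnSn _.
have bound : eps / (9 * M) * (x m + x m.+1 + x m.+2 - (x 0%N + x 1%N + x 2%N)) <= eps / 3.
  have -> : eps / 3 = eps / (9 * M) * (M + M + M - (0 + 0 + 0)).
    by field; rewrite gt_eqF.
  rewrite ler_pM2l// lerB ?lerD//; try exact: x_ge0; exact: x_leM.
have near0 j : (j <= 2)%N -> `|G (x j)| <= eps / 3.
  move=> j2; have jm : (j <= m.+2)%N := leq_trans j2 (isT : (2 <= m.+2)%N).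
  rewrite -normrN -[- _]add0r -G0; apply: r0P.
    by rewrite in_itv/= x_ge0// x_leM.
  rewrite sub0r normrN (ger0_norm (x_ge0 _ jm)).
  have [s1 _ s1r0 _] := step' 0%N isT; have [s2 _ s2r0 _] := step' 1%N isT.
  apply: le_lt_trans (x_mono _ _ j2 isT) _.
  have x0x : x 0%N - x 0%N < r0 / 3 by rewrite subrr divr_gt0.
  by have := three_steps_lt x0x s1r0 s2r0; rewrite x0 subr0.
have nearL j : (m <= j)%N -> (j <= m.+2)%N -> `|I - G (x j)| <= eps / 3.
  move=> mj jm; rewrite -GL; apply: r1P; first by rewrite in_itv/= x_ge0// x_leM.
  have [t1 _ _ t1r1] := step' m le_m1; have [t2 _ _ t2r1] := step' m.+1 (leqnn _).
  have x0x : x 0%N - x 0%N < r1 / 3 by rewrite subrr divr_gt0.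
  have xmm : x m - x m < r1 / 3 by rewrite subrr divr_gt0.
  have len := three_steps_lt xmm t1r1 t2r1.
  rewrite ltr_norml ltrNl opprB; apply/andP; split; apply: le_lt_trans len.
    by rewrite lerB// x_mono.
  by rewrite lerB// x_mono.
move=> h; apply: close_to_telescope (le_trans h bound) _ _ _ _ _ _;
  by [exact: near0|exact: nearL].
Qed.

End FinePartitions.

(** * Inscribed polygonals *)

Lemma cross0r (R : realType) (u : 'rV[R]_3) : cross u 0 = 0.
Proof. by rewrite -(scale0r 0) crossZr !scale0r. Qed.

Lemma cross0l (R : realType) (u : 'rV[R]_3) : cross 0 u = 0.
Proof. by rewrite -(scale0r 0) crossZl !scale0r. Qed.

(** Every chord is a factor of one of the nonzero cross products. *)
Lemma chords_neq (R : realType) (c : R -> 'rV[R]_3) (x : nat -> R) m : (0 < m)%N ->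
  (forall i, (i < m)%N ->
    cross (c (x i.+1) - c (x i)) (c (x i.+2) - c (x i.+1)) != 0 /\
    cross (c (x i.+2) - c (x i.+1)) (c (x i.+3) - c (x i.+2)) != 0) ->
  forall i, (i < m.+2)%N -> c (x i) != c (x i.+1).
Proof.
move=> m0 nz.
have neql a b u : cross (a - b) u != 0 -> b != a.
  by apply: contraNneq => ->; rewrite subrr cross0l.
have neqr a b u : cross u (a - b) != 0 -> b != a.
  by apply: contraNneq => ->; rewrite subrr cross0r.
case=> [|[|i]] im; first by have [/neql] := nz 0%N m0.
  by have [/neqr] := nz 0%N m0.
by have [_ /neqr] := nz i im.
Qed.

Section Polygonals.
Variables (R : realType) (c : R -> 'rV[R]_3).
Implicit Types (L : R) (l : seq R).

Lemma size_inscribed l : (size (inscribed 0 c l)).-1 = size l.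
Proof. by rewrite size_map. Qed.

Lemma nth_inscribed l i : (i <= size l)%N ->
  nth 0 (inscribed 0 c l) i = c (nth 0 (0 :: l) i).
Proof. by move=> il; rewrite (nth_map 0). Qed.

Lemma discard_repeated_inscribed l :
  (forall i, (i < size l)%N -> c (nth 0 (0 :: l) i) != c (nth 0 (0 :: l) i.+1)) ->
  discard_repeated (inscribed 0 c l) = inscribed 0 c l.
Proof.
move=> neq; apply: discard_repeated_id; rewrite /inscribed /=.
apply/(pathP (0 : 'rV[R]_3)) => i; rewrite size_map => il.
have := neq i il; rewrite -(nth_inscribed (ltnW il)) -(nth_inscribed (l := l) (i := i.+1))//.
Qed.

Lemma TAT_polygonal_open l m : size l = m.+2 -> (0 < m)%N ->
  let x := nth 0 (0 :: l) in
  (forall i, (i < m)%N ->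
    cross (c (x i.+1) - c (x i)) (c (x i.+2) - c (x i.+1)) != 0 /\
    cross (c (x i.+2) - c (x i.+1)) (c (x i.+3) - c (x i.+2)) != 0) ->
  c 0 != c (last 0 l) ->
  TAT_polygonal (inscribed 0 c l) =
  \sum_(i < m) plane_angle c (x i) (x i.+1) (x i.+2) (x i.+3).
Proof.
move=> lm m0 x nz c0L; rewrite /TAT_polygonal discard_repeated_inscribed; last first.
  by move=> i; rewrite lm; exact: chords_neq m0 nz i.
rewrite /inscribed /= last_map (negbTE c0L) -/(inscribed 0 c l).
rewrite /TAT_open size_inscribed lm.
apply: (@sum_dRP2_discrete_binormal _ _ _ c x m) nz => i im.
by rewrite nth_inscribed ?lm.
Qed.

(** The partition continued by one more turn, shifted by [L]. *)
Definition cyclic_partition L l (i : nat) : R :=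
  if (i <= size l)%N then nth 0 (0 :: l) i else L + nth 0 (0 :: l) (i - size l).

Lemma TAT_polygonal_closed L l : itv_partition 0 L l -> (2 < size l)%N ->
  c 0 = c L ->
  let x := cyclic_partition L l in let c' := periodic_ext L c in
  (forall i, (i < size l)%N ->
    cross (c' (x i.+1) - c' (x i)) (c' (x i.+2) - c' (x i.+1)) != 0 /\
    cross (c' (x i.+2) - c' (x i.+1)) (c' (x i.+3) - c' (x i.+2)) != 0) ->
  TAT_polygonal (inscribed 0 c l) =
  \sum_(i < size l) plane_angle c' (x i) (x i.+1) (x i.+2) (x i.+3).
Proof.
move=> lL l2 c0L x c' nz.
have l0 : (0 < size l)%N by exact: leq_trans l2.
have x_le i : (i <= size l)%N -> c' (x i) = c (nth 0 (0 :: l) i).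
  move=> il; rewrite /x /cyclic_partition il /c' /periodic_ext.
  rewrite (set_nth_default L) ?ltnS//.
  by rewrite (itv_partition_nth_le _ lL).
have x_gt i : (size l < i)%N -> (i <= (size l).+2)%N ->
    c' (x i) = c (nth 0 (0 :: l) (i - size l)).
  move=> li il; rewrite /x /cyclic_partition leqNgt li /= /c' /periodic_ext.
  have il' : (i - size l <= size l)%N by lia.
  have lt1 : ((i - size l).-1 < size l)%N by lia.
  have pos : 0 < nth 0 (0 :: l) (i - size l).
    have := lL.1 => /(order_path_min (@lt_trans _ _))/allP; apply.
    have -> : (i - size l)%N = (i - size l).-1.+1 by lia.
    by rewrite /=; apply: mem_nth; exact: lt1.
  by rewrite [_ <= L]leNgt ltrDl pos /= addrC addKr.
rewrite /TAT_polygonal discard_repeated_inscribed; last first.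
  move=> i il; rewrite -x_le ?(ltnW il)// -x_le//.
  exact: chords_neq l0 nz i (leqW (leqW il)).
have lastL : last 0 l = L by exact/eqP/lL.2.
rewrite {1 2}/inscribed /= last_map lastL c0L eqxx.
rewrite /TAT_closed size_inscribed.
apply: (@sum_dRP2_discrete_binormal _ _ _ c' x (size l)) nz => i im.
have [il|il|->] := ltngtP i (size l).
- by rewrite modn_small// nth_inscribed ?(ltnW il)// x_le ?(ltnW il).
- rewrite x_gt//.
  have -> : (i %% size l = i - size l)%N.
    by rewrite -{1}(subnK (ltnW il)) modnDr modn_small//; lia.
  by rewrite nth_inscribed//; lia.
- rewrite modnn nth_inscribed// x_le// c0L (itv_partition_nth_size _ lL)//.
Qed.

End Polygonals.

(** * Convergence of the total absolute torsion *)

Section SmoothUnitSpeedCurve.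
Variables (R : realType) (L : R) (c : R -> 'rV[R]_3).
Hypothesis L_gt0 : 0 < L.
Hypothesis c_smooth : smooth_curve 0 L c.
Hypothesis c_unit : arc_length_param 0 L c.
Hypothesis c_ddot_neq0 : forall s : R, s \in `[0, L] -> derivn_in 0 L 2 c s != 0.
Implicit Types (l : seq R) (e d : R).

Let D i := derivn_in 0 L i c.

Lemma first_order_derivn i : first_order 0 L (D i) (D i.+1).
Proof. by apply: first_order_deriv_in => x; exact: (@c_smooth.1 i x). Qed.

Lemma derivn_chain i k :
  derivative_on 0 L (fun t => D i t 0 k) (fun t => D i.+1 t 0 k).
Proof. exact/first_order_coord/first_order_derivn. Qed.

Lemma derivn_regular s : s \in `[0, L] -> cross (D 1 s) (D 2 s) != 0.
Proof.
move=> sL; rewrite -enorm_eq0 enorm_cross_derivn//; last exact: c_smooth.1.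
by rewrite enorm_eq0 c_ddot_neq0.
Qed.

Let I : R := fine (\int[lebesgue_measure]_(s in `[0%R, L])
  (torsion_density (D 1 s) (D 2 s) (D 3 s))%:E)%E.

Definition mesh_lt l d :=
  forall i, (i < size l)%N -> nth 0 (0 :: l) i.+1 - nth 0 (0 :: l) i < d.

Lemma partition_step_gt0 l : itv_partition 0 L l ->
  forall i, (i < size l)%N -> 0 < nth 0 (0 :: l) i.+1 - nth 0 (0 :: l) i.
Proof.
by move=> [/(pathP 0) lL _] i il; rewrite subr_gt0; exact: lL.
Qed.

Lemma partition_in l i : itv_partition 0 L l -> (i <= size l)%N ->
  0 <= nth 0 (0 :: l) i <= L.
Proof.
move=> lL il; rewrite (set_nth_default L) ?ltnS//.
by rewrite (itv_partition_nth_ge _ lL)// (itv_partition_nth_le _ lL).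
Qed.

(** Three segments are needed for every segment to belong to a quadruple, and
    for the first two indices of a second turn not to wrap around again. *)
Lemma fine_partition_size l : itv_partition 0 L l -> mesh_lt l (L / 3) ->
  (2 < size l)%N.
Proof.
move=> lL mesh; rewrite ltnNge; apply/negP => l2.
have lastL := itv_partition_nth_size 0 lL.
move: l2 mesh lastL; rewrite /mesh_lt; case: l {lL} => [|a [|b [|//]]] _ /=.
- by move=> _ L0; move: L_gt0; rewrite -L0 ltxx.
- by move=> /(_ 0%N isT) /= + aL; rewrite aL; move: L_gt0; lra.
- move=> mesh bL; have /= := mesh 0%N isT; have /= := mesh 1%N isT.
  by rewrite bL; move: L_gt0; lra.
Qed.

(** The sum over an open polygonal ends with the quadruple whose last point is
    [L], so its number of terms is two less than the number of segments. *)
Lemma open_partition_cvg e : 0 < e -> c 0 != c L ->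
  exists2 d, 0 < d & forall l, itv_partition 0 L l -> mesh_lt l d ->
    `|TAT_polygonal (inscribed 0 c l) - I| <= e.
Proof.
move=> e0 c0L.
have [d d0 dP] := sum_plane_angle_cvg L_gt0 (lexx L)
  (fun i k _ => @derivn_chain i k) (fun k => (@derivn_chain 3 k).1) derivn_regular e0.
exists (Num.min d (L / 3)); first by rewrite lt_min d0 divr_gt0.
move=> l lL mesh.
have l2 : (2 < size l)%N.
  by apply: fine_partition_size => // i /mesh; rewrite lt_min => /andP[].
pose m := (size l).-2; have lm : size l = m.+2 by rewrite /m; lia.
have m0 : (0 < m)%N by rewrite /m; lia.
have xL : nth 0 (0 :: l) m.+2 = L by rewrite -lm; exact: itv_partition_nth_size lL.
have [|||i im|nz] := dP m (nth 0 (0 :: l)) erefl.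
- have mn : (m <= size l)%N by rewrite lm; exact: leqW (leqnSn m).
  by have /andP[] := partition_in lL mn.
- by rewrite xL.
- by rewrite xL.
- rewrite partition_step_gt0 ?lm//=.
  by have := mesh i; rewrite lm lt_min => /(_ im)/andP[].
rewrite (TAT_polygonal_open lm m0 nz)//.
by have /eqP -> := lL.2.
Qed.

Lemma cyclic_partition_step l : itv_partition 0 L l -> (2 < size l)%N ->
  forall i, (i < (size l).+2)%N -> exists2 j, (j < size l)%N &
    cyclic_partition L l i.+1 - cyclic_partition L l i =
    nth 0 (0 :: l) j.+1 - nth 0 (0 :: l) j.
Proof.
move=> lL l2 i il; rewrite /cyclic_partition.
have [li|li|li] := ltngtP i (size l); first by exists i.
- have -> : i = (size l).+1 by lia.
  exists 1%N; first exact: leq_trans l2.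
  have -> : ((size l).+2 - size l = 2)%N by lia.
  have -> : ((size l).+1 - size l = 1)%N by lia.
  by rewrite opprD addrACA subrr add0r.
- exists 0%N; first exact: leq_trans l2.
  by rewrite li subSnn (itv_partition_nth_size _ lL) addrC addKr/= subr0.
Qed.

(** The periodic extension has derivatives of all orders, since those of [c]
    agree at the end points. *)
Lemma closed_partition_cvg e : 0 < e -> c 0 = c L ->
  exists2 d, 0 < d & forall l, itv_partition 0 L l -> mesh_lt l d ->
    `|TAT_polygonal (inscribed 0 c l) - I| <= e.
Proof.
move=> e0 c0L.
pose C i := periodic_ext L (D i).
have C_chain i k :
    derivative_on 0 (L + L) (fun t => C i t 0 k) (fun t => C i.+1 t 0 k).
  apply/first_order_coord/first_order_periodic_ext; last exact: first_order_derivn.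
    exact: c_smooth.2 c0L i.
  exact: c_smooth.2 c0L i.+1.
have C_regular s : s \in `[0, L + L] -> cross (C 1 s) (C 2 s) != 0.
  rewrite in_itv/= => /andP[s0 sL]; rewrite /C /periodic_ext.
  case: leP => Ls; apply: derivn_regular; rewrite in_itv/=; first by rewrite s0.
  by rewrite subr_ge0 (ltW Ls) lerBlDr.
have IC : fine (\int[lebesgue_measure]_(s in `[0%R, L])
    (torsion_density (C 1 s) (C 2 s) (C 3 s))%:E)%E = I.
  congr fine; apply: eq_integral => s; rewrite inE/= in_itv/= => /andP[_ sL].
  by rewrite /C /periodic_ext sL.
have LLL : L <= L + L by rewrite lerDl ltW.
have [d d0 dP] := sum_plane_angle_cvg L_gt0 LLL
  (fun i k _ => @C_chain i k) (fun k => (@C_chain 3 k).1) C_regular e0.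
rewrite IC in dP.
exists (Num.min d (L / 3)); first by rewrite lt_min d0 divr_gt0.
move=> l lL mesh.
have l2 : (2 < size l)%N.
  by apply: fine_partition_size => // i /mesh; rewrite lt_min => /andP[].
pose x := cyclic_partition L l.
have xn : x (size l) = L.
  by rewrite /x /cyclic_partition leqnn; exact: itv_partition_nth_size lL.
have xn2 : x (size l).+2 = L + nth 0 (0 :: l) 2.
  rewrite /x /cyclic_partition ltnNge leqnSn/=.
  by have -> : ((size l).+2 - size l = 2)%N by lia.
have /andP[x2_ge0 x2_leL] := partition_in lL (ltnW l2).
have [|||i im|nz] := dP (size l) x erefl.
- by rewrite xn.
- by rewrite xn2 lerDl.
- by rewrite xn2 lerD2l.
- have [j jl ->] := cyclic_partition_step lL l2 im.
  rewrite partition_step_gt0//=.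
  by have := mesh j jl; rewrite lt_min => /andP[].
by rewrite (TAT_polygonal_closed lL l2 c0L nz).
Qed.

Lemma partition_cvg e : 0 < e ->
  exists2 d, 0 < d & forall l, itv_partition 0 L l -> mesh_lt l d ->
    `|TAT_polygonal (inscribed 0 c l) - I| <= e.
Proof.
move=> e0; have [c0L|c0L] := eqVneq (c 0) (c L).
  exact: closed_partition_cvg.
exact: open_partition_cvg.
Qed.

(** A long step of the partition contains a chord that is not short, because
    chords are comparable with the parameter intervals; hence the arc over it
    does not have small diameter. *)
Lemma modulus_mesh d : 0 < d -> exists2 e, 0 < e & forall l,
  itv_partition 0 L l -> (modulus 0 c l < e%:E)%E -> mesh_lt l d.
Proof.
move=> d0.
have [r r0 rP] := chord_lower_bound
  (fun i k _ => @derivn_chain i k) (fun k => (@derivn_chain 3 k).1) c_unit.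
pose h := Num.min d (r / 2).
have h0 : 0 < h by rewrite lt_min d0 divr_gt0.
have hr : h < r by rewrite gt_min ltr_pdivrMr// ltr_pMr// ltr1n orbT.
(* In an interval of length [h] the middle third gives a chord of length at
   least [h / 6]. *)
exists (h / 6); first by rewrite divr_gt0.
move=> l lL lmod i il; rewrite ltNge; apply/negP => step.
have hd : h <= nth 0 (0 :: l) i.+1 - nth 0 (0 :: l) i.
  by apply: le_trans step; rewrite ge_min lexx.
have /andP[p0 _] := partition_in lL (ltnW il).
have /andP[_ qL] := partition_in lL il.
move: lmod; rewrite ltNge => /negP; apply.
rewrite /modulus; apply: le_trans (le_bigmax _ _ (Ordinal il)) => /=.
set p := nth 0 (0 :: l) i in hd p0 *; rewrite -[l`_i]/(nth 0 (0 :: l) i.+1).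
set q := nth 0 (0 :: l) i.+1 in hd qL *.
pose y := p + h / 3; pose z := p + 2 * h / 3.
have yq : p <= y <= q by rewrite /y; apply/andP; split; lra.
have zq : p <= z <= q by rewrite /z; apply/andP; split; lra.
apply: le_trans (ereal_sup_ubound _); last first.
  exists (c z, c y) => //=; split; [exists z|exists y] => //=; by rewrite in_itv.
rewrite lee_fin /=; have -> : h / 6 = (z - y) / 2 by rewrite /z /y; field.
by apply: (rP p y z (p + h)); rewrite /z /y//; lra.
Qed.

(** The crude constant 3 comes from applying the mean value theorem to each
    coordinate separately. *)
Lemma curve_lipschitz x y : x \in `[0, L] -> y \in `[0, L] ->
  enorm (c x - c y) <= 3 * `|x - y|.
Proof.
have coord_le k u v : 0 <= u -> u < v -> v <= L -> `|c v 0 k - c u 0 k| <= v - u.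
  move=> u0 uv vL; have [xi /andP[uxi xiv] ->] := mean_value (@derivn_chain 0 k) u0 uv vL.
  rewrite normrM (gtr0_norm (x := v - u)) ?subr_gt0//.
  apply: ler_piMl; first by rewrite subr_ge0 ltW.
  rewrite -(@expr_le1 _ 2)// real_normK ?num_real//.
  have xiL : xi \in `[0, L].
    by rewrite in_itv/= (le_trans u0 (ltW uxi)) (le_trans (ltW xiv) vL).
  have := enorm_sqr (D 1 xi); rewrite (c_unit xiL) expr1n => ->.
  rewrite /dot (bigD1 k)//= expr2 lerDl; apply: sumr_ge0 => j _.
  by rewrite -expr2 sqr_ge0.
have coord_le' k u v : u \in `[0, L] -> v \in `[0, L] -> `|c v 0 k - c u 0 k| <= `|v - u|.
  rewrite !in_itv/= => /andP[u0 uL] /andP[v0 vL].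
  have [uv|vu|->] := ltgtP u v; last by rewrite !subrr.
    by rewrite (gtr0_norm (x := v - u)) ?subr_gt0// coord_le.
  by rewrite distrC [leRHS]distrC (gtr0_norm (x := u - v)) ?subr_gt0// coord_le.
move=> xL yL; rewrite -(@ler_pXn2r _ 2) ?nnegrE ?enorm_ge0 ?mulr_ge0//.
have sq k : (c x - c y) 0 k * (c x - c y) 0 k <= `|x - y| ^+ 2.
  rewrite -expr2 -real_normK ?num_real// ler_pXn2r ?nnegrE// !mxE.
  exact: coord_le'.
rewrite enorm_sqr dot3E exprMn.
have := sq (inord 0); have := sq (inord 1); have := sq (inord 2).
have := sqr_ge0 (`|x - y|); lra.
Qed.

(** Needed for the lower bound: the supremum that defines [TAT_sup] is taken over
    a nonempty set. *)
Lemma fine_partition_exists e : 0 < e ->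
  exists2 l, itv_partition 0 L l & (modulus 0 c l < e%:E)%E.
Proof.
move=> e0; pose N := (Num.truncn (3 * L / e)).+1.
have N0 : 0 < N%:R :> R by rewrite ltr0n.
have NL : 3 * (L / N%:R) < e.
  have : 3 * L / e < N%:R by exact: truncnS_gt.
  by rewrite mulrA !ltr_pdivrMr// [e * _]mulrC.
pose l := mkseq (fun i => L * i.+1%:R / N%:R) N.
have nthl i : (i <= N)%N -> nth 0 (0 :: l) i = L * i%:R / N%:R.
  by case: i => [_|i iN]; [rewrite mulr0 mul0r|rewrite /= nth_mkseq].
have szl : size l = N by rewrite size_mkseq.
have lL : itv_partition 0 L l.
  split.
    apply/(pathP 0) => i; rewrite szl => iN.
    rewrite nthl ?(ltnW iN)// -[nth 0 l i]/(nth 0 (0 :: l) i.+1) nthl//.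
    by rewrite ltr_pM2r ?invr_gt0// ltr_pM2l// ltr_nat.
  by rewrite (last_nth 0) szl nthl// mulfK// gt_eqF.
exists l => //; rewrite /modulus; apply: bigmax_lt; first by rewrite lte_fin.
move=> [i il] _ /=; rewrite -[l`_i]/(nth 0 (0 :: l) i.+1).
apply: le_lt_trans (_ : ((3 * (L / N%:R))%:E < _)%E); last by rewrite lte_fin.
apply: ge_ereal_sup => _ /= [[u v] /= [[x + <-] [y + <-]] <-].
have /andP[p0 pL] := partition_in lL (ltnW il).
have /andP[q0 qL] := partition_in lL il.
rewrite !in_itv/= => /andP[px xq] /andP[py yq].
have qp : nth 0 (0 :: l) i.+1 - nth 0 (0 :: l) i = L / N%:R.
  rewrite !nthl -?szl ?(ltnW il)// -mulrBl -mulrBr -natrB ?leqnSn// subSnn.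
  by rewrite mulr1.
rewrite lee_fin; apply: le_trans (curve_lipschitz _ _) _.
- by rewrite in_itv/= (le_trans p0 px) (le_trans xq qL).
- by rewrite in_itv/= (le_trans p0 py) (le_trans yq qL).
rewrite ler_pM2l// -qp ler_norml; apply/andP; split; lra.
Qed.

Lemma TAT_sup_cvg : TAT_sup 0 L c e @[e --> 0^'+] --> I%:E.
Proof.
have bound e : 0 < e -> exists2 d, 0 < d & forall r, 0 < r -> r < d ->
    ((I - e)%:E <= TAT_sup 0 L c r <= (I + e)%:E)%E.
  move=> e0; have [d d0 dP] := partition_cvg e0.
  have [r0 r00 rP] := modulus_mesh d0.
  exists r0 => // r r_gt0 rr0.
  have near l : itv_partition 0 L l -> (modulus 0 c l < r%:E)%E ->
      `|TAT_polygonal (inscribed 0 c l) - I| <= e.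
    move=> lL lr; apply: dP => //; apply: rP => //.
    by apply: lt_trans lr _; rewrite lte_fin.
  apply/andP; split.
    have [l lL lr] := fine_partition_exists r_gt0.
    apply: le_trans (ereal_sup_ubound _); last by exists l.
    by have := near l lL lr; rewrite lee_fin ler_norml => /andP[]; lra.
  apply: ge_ereal_sup => _ [l [lL lr] <-].
  by have := near l lL lr; rewrite lee_fin ler_norml => /andP[]; lra.
have bound' e : 0 < e -> \forall r \near (0 : R)^'+,
    ((I - e)%:E <= TAT_sup 0 L c r <= (I + e)%:E)%E.
  move=> e0; have [d d0 dP] := bound e e0.
  near=> r; apply: dP; near: r; first exact: nbhs_right_gt.
  exact: nbhs_right_lt.
apply/fine_cvgP; split.
  apply: filterS (bound' 1 ltr01) => r /andP[lo hi].
  by rewrite fin_numE -ltNye -ltey (lt_le_trans (ltNyr _) lo) (le_lt_trans hi (ltry _)).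
apply/cvgrPdist_le => e e0; apply: filterS (bound' e e0) => r /andP[lo hi].
have fin : TAT_sup 0 L c r \is a fin_num.
  by rewrite fin_numE -ltNye -ltey (lt_le_trans (ltNyr _) lo) (le_lt_trans hi (ltry _)).
move: lo hi; rewrite -(fineK fin) !lee_fin /= => lo hi.
by rewrite ler_norml; apply/andP; split; lra.
Unshelve. all: by end_near. Qed.

Lemma integral_torsion : (I%:E =
  \int[lebesgue_measure]_(s in `[0%R, L]) (`|torsion 0 L c s|%R)%:E)%E.
Proof.
have -> : (\int[lebesgue_measure]_(s in `[0%R, L]) (`|torsion 0 L c s|%R)%:E =
    \int[lebesgue_measure]_(s in `[0%R, L])
      (torsion_density (D 1 s) (D 2 s) (D 3 s))%:E)%E.
  apply: eq_integral => s; rewrite inE/= => sL.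
  by rewrite norm_torsion//; exact: c_smooth.1.
have cont : {within `[0, L], continuous
    (fun s => torsion_density (D 1 s) (D 2 s) (D 3 s))}.
  exact: torsion_density_continuous (fun i k _ => @derivn_chain i k)
    (fun k => (@derivn_chain 3 k).1) derivn_regular.
have [G _ [_ GI]] := primitive_exists L_gt0 cont.
by rewrite /I GI ?in_itv/= ?lexx ?ltW.
Qed.

End SmoothUnitSpeedCurve.

Theorem corollary3p2 (R : realType) (L : R) (c : R -> 'rV[R]_3)
    (L_gt0 : 0 < L)
    (c_smooth : smooth_curve 0 L c)
    (c_arc_length : arc_length_param 0 L c)
    (c_ddot_neq0 : forall s : R, s \in `[0, L] -> derivn_in 0 L 2 c s != 0) :
  TAT 0 L c =
    (\int[lebesgue_measure]_(s in `[0%R, L]) (`|torsion 0 L c s|%R)%:E)%E.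
Proof.
rewrite -(integral_torsion L_gt0 c_smooth c_arc_length c_ddot_neq0).
apply: cvg_lim; first exact: ereal_hausdorff.
exact: TAT_sup_cvg.
Qed.
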